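(* Consider $dy_t=S(t)dt+d\xi_t$, $0\le t\le n$, with noise distribution in a family $\mathcal{Q}_n$ satisfying: $\mathcal{Q}_n\subseteq\{Q:\ \mathbf{L}_{1,n}(Q)+\mathbf{L}_{2,n}(Q)\le l_n\}$, and $$0<\varsigma_*:=\inf_{Q\in\mathcal{Q}_n}\varsigma_Q\le\sup_{Q\in\mathcal{Q}_n}\varsigma_Q=:\varsigma^*<\infty,\qquad \sigma^*:=\sup_{Q\in\mathcal{Q}_n}\sigma_Q<\infty .$$ Then for any $n\ge1$ and $0<\rho<1/3$ the model selection estimator $\widehat S_*$ (with finite weight set $\Gamma$, $\nu=\mathrm{card}(\Gamma)$, $\mu=\max_{\gamma\in\Gamma}\#(\gamma)$, variance estimator $\widehat\sigma_n$ and penalty coefficient $\rho$) satisfies $$\mathcal{R}^*_n(\widehat S_*,S)\le\frac{1+3\rho-2\rho^2}{1-3\rho}\min_{\gamma\in\Gamma}\mathcal{R}^*_n(\widehat S_\gamma,S)+\frac1n\mathcal{B}^*(n,\rho),$$ where $$\mathcal{B}^*(n,\rho)=\Psi^*(n,\rho)+\frac{6\mu}{1-3\rho}\sup_{Q\in\mathcal{Q}_n}\mathbf{E}_{Q,S}|\widehat\sigma_n-\varsigma_Q|,\qquad \Psi^*(n,\rho)=\frac{2\varsigma^*\sigma^*\nu+4\varsigma^*l_n+2\nu l_n}{\varsigma_*\,\rho\,(1-3\rho)}.$$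
   Context: Model: $n$ is a positive integer, $S$ is an unknown 1-periodic function in $L_2[0,1]$, and $(\xi_t)_{0\le t\le n}$ is an unobservable semimartingale with values in the Skorokhod space $\mathcal{D}[0,n]$ whose distribution $Q$ belongs to a family $\mathcal{Q}_n$ of probability measures on $\mathcal{D}[0,n]$. For every $Q\in\mathcal{Q}_n$ and $f\in L_2[0,n]$ the integral $I_n(f)=\int_0^nf_s\,d\xi_s$ is well defined with $\mathbf{E}_QI_n(f)=0$ and $\mathbf{E}_QI_n^2(f)\le\sigma_Q\int_0^nf_s^2ds$, for a constant $\sigma_Q>0$ attached to $Q$. $\mathbf{E}_{Q,S}$ is expectation under the law of $(y_t)_{0\le t\le n}$. Risks: $\mathcal{R}_Q(\widehat S,S)=\mathbf{E}_{Q,S}\|\widehat S-S\|^2$ with $\|f\|^2=\int_0^1f^2(t)dt$, and robust risk $\mathcal{R}^*_n(\widehat S,S)=\sup_{Q\in\mathcal{Q}_n}\mathcal{R}_Q(\widehat S,S)$. Basis: $\phi_1=1$ and, for $j\ge2$, $\phi_j(x)=\sqrt2\cos(2\pi[j/2]x)$ for even $j$, $\sqrt2\sin(2\pi[j/2]x)$ for odd $j$ ($[\cdot]$ integer part). $\xi_{j,n}=n^{-1/2}I_n(\phi_j)$. For a sequence $x=(x_j)$, $|x|^2=\sum_jx_j^2$, $\#(x)=\sum_j\mathbf{1}_{\{|x_j|>0\}}$. To each $Q$ is attached a constant $\varsigma_Q>0$ with $$\mathbf{L}_{1,n}(Q)=\sup_{x\in[-1,1]^\infty,\ \#(x)\le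 n}\Bigl|\sum_{j\ge1}x_j(\mathbf{E}_Q\xi_{j,n}^2-\varsigma_Q)\Bigr|<\infty,\qquad \mathbf{L}_{2,n}(Q)=\sup_{|x|\le1,\ \#(x)\le n}\mathbf{E}_Q\Bigl(\sum_{j\ge1}x_j(\xi_{j,n}^2-\mathbf{E}_Q\xi_{j,n}^2)\Bigr)^2<\infty .$$ $(l_n)$ is a fixed positive increasing sequence with $l_n\to\infty$ and $l_n/n^\delta\to0$ for every $\delta>0$. Estimators: $\widehat\theta_{j,n}=\frac1n\int_0^n\phi_j(t)dy_t$. $\Gamma$ is a finite set of weight sequences $\gamma=(\gamma(j))_{j\ge1}$ with $0\le\gamma(j)\le1$, $0<\#(\gamma)\le n$. $\widehat S_\gamma=\sum_{j\ge1}\gamma(j)\widehat\theta_{j,n}\phi_j$. $\widehat\sigma_n$ is some estimator (measurable function of $(y_t)_{0\le t\le n}$) of $\varsigma_Q$; $\widetilde\theta_{j,n}=\widehat\theta_{j,n}^2-\widehat\sigma_n/n$; $\widehat P_n(\gamma)=\widehat\sigma_n|\gamma|^2/n$; $J_n(\gamma)=\sum_j\gamma^2(j)\widehat\theta_{j,n}^2-2\sum_j\gamma(j)\widetilde\theta_{j,n}+\rho\widehat P_n(\gamma)$. $\widehat\gamma$ is a minimizer of $J_n$ over $\Gamma$ and $\widehat S_*=\widehat S_{\widehat\gamma}$. *)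

(* Defs.v *)
From HB Require Import structures.
From mathcomp Require Import all_boot all_order all_algebra finmap.
From mathcomp Require Import all_classical all_reals all_analysis.
From mathcomp Require Import ring lra measurable_realfun.
Set Implicit Arguments.
Unset Strict Implicit.
Unset Printing Implicit Defensive.
Import Order.TTheory GRing.Theory Num.Theory.
Import numFieldNormedType.Exports.
Local Open Scope classical_set_scope.
Local Open Scope ring_scope.

(* Real-valued series; the library only declares this notation for \bar R. *)
Notation "\sum_ ( m <= i <oo ) F" :=
  (\big[+%R/0%R]_(m <= i <oo) F%R) : ring_scope.

Section skorokhod_space.
Context {R : realType}.

Definition cadlag (T : R) (f : R -> R) :=
  (forall t, 0 <= t < T -> f x @[x --> t^'+] --> f t) /\
  (forall t, 0 < t <= T -> cvg (f x @[x --> t^'-])).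

(* The paths of D[0,n] are extended by 0 outside [0,n], so that two paths are
   equal as soon as they agree on [0,n]. *)
Record skorokhod (n : nat) := Skorokhod {
  sk_fun :> R -> R;
  sk_cadlag : cadlag n%:R sk_fun;
  sk_out : forall t, ~~ (0 <= t <= n%:R) -> sk_fun t = 0 }.

Lemma cadlag0 (T : R) : cadlag T (fun=> 0).
Proof. by split=> t _; [exact: cvg_cst|exact: is_cvg_cst]. Qed.

Definition skorokhod0 n : skorokhod n :=
  Skorokhod (cadlag0 n%:R) (fun _ _ => erefl).

Lemma skorokhod_eq n (f g : skorokhod n) : sk_fun f = sk_fun g -> f = g.
Proof.
case: f g => f fc fo [g gc go] /= fg; subst g.
by rewrite (Prop_irrelevance fc gc) (Prop_irrelevance fo go).
Qed.

HB.instance Definition _ n := gen_eqMixin (skorokhod n).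
HB.instance Definition _ n := gen_choiceMixin (skorokhod n).
HB.instance Definition _ n := isPointed.Build (skorokhod n) (skorokhod0 n).

(* The Borel sigma-algebra of the Skorokhod topology is generated by the
   evaluations. *)
Definition evaluation_sets n : set (set (skorokhod n)) :=
  [set A | exists (t : R) (B : set R), measurable B /\
    A = [set f : skorokhod n | B (f t)]].

HB.instance Definition _ n :=
  @isMeasurable.Build (sigma_display (@evaluation_sets n)) (skorokhod n)
    <<s @evaluation_sets n >> (@sigma_algebra0 _ setT (@evaluation_sets n))
    (@sigma_algebraC _ (@evaluation_sets n))
    (@sigma_algebra_bigcup _ setT (@evaluation_sets n)).

Definition coord_process n (t : R) (f : skorokhod n) : R := f t.

End skorokhod_space.
Arguments skorokhod : clear implicits.
Arguments coord_process {R} n t f.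

Section semimartingales.
Context {R : realType} (n : nat) d (T : measurableType d) (P : probability T R).
Implicit Types (F : R -> set (set T)) (X : R -> T -> R).

Definition filtration F :=
  (forall t, 0 <= t <= n%:R ->
    sigma_algebra setT (F t) /\ F t `<=` measurable) /\
  (forall s t, 0 <= s -> s <= t -> t <= n%:R -> F s `<=` F t).

Definition adapted F X := forall t, 0 <= t <= n%:R ->
  forall B : set R, measurable B -> F t (X t @^-1` B).

Definition martingale F X :=
  [/\ adapted F X,
      forall t, 0 <= t <= n%:R -> P.-integrable setT (EFin \o X t) &
      forall s t, 0 <= s -> s <= t -> t <= n%:R -> forall B, F s B ->
        (\int[P]_(w in B) (X t w)%:E = \int[P]_(w in B) (X s w)%:E)%E].

(* A value larger than n plays the role of +oo. *)
Definition stopping_time F (tau : T -> R) :=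
  (forall w, 0 <= tau w) /\
  (forall t, 0 <= t <= n%:R -> F t [set w | tau w <= t]).

(* On a finite horizon, a localizing sequence eventually reaches n. *)
Definition local_martingale F X :=
  adapted F X /\
  exists tau : nat -> T -> R,
    [/\ forall k, stopping_time F (tau k),
        forall k w, tau k w <= tau k.+1 w,
        {ae P, forall w, exists k, n%:R <= tau k w} &
        forall k, martingale F (fun t w => X (Num.min t (tau k w)) w)].

Definition semimartingale F (X : T -> skorokhod R n) :=
  exists (X0 : T -> R) (M A : T -> skorokhod R n),
    [/\ forall B : set R, measurable B -> F 0 (X0 @^-1` B),
        local_martingale F (fun t w => M w t) /\ (forall w, M w 0 = 0),
        adapted F (fun t w => A w t) /\ (forall w, A w 0 = 0),
        forall w, bounded_variation 0 n%:R (A w) &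
        forall w t, 0 <= t <= n%:R -> X w t = X0 w + M w t + A w t].

End semimartingales.

Definition semimartingale_law (R : realType) (n : nat)
    (Q : probability (skorokhod R n) R) :=
  exists d (T : measurableType d) (P : probability T R)
    (F : R -> set (set T)) (X : {mfun T >-> skorokhod R n}),
    [/\ filtration n F, semimartingale P F X &
        forall B, measurable B -> Q B = distribution P X B].

Section stochastic_integral.
Context {R : realType}.
Notation mu := (@lebesgue_measure R).

Definition sq_integrable (T : R) (f : R -> R) :=
  measurable_fun `[0, T] f /\
  (\int[mu]_(x in `[0%R, T]) ((f x) ^+ 2)%:E < +oo)%E.

(* (a, (s, t)) stands for the function equal to a on ]s, t] and 0 elsewhere;
   a list stands for the sum of its elements. *)
Definition step_data := seq (R * (R * R)).

Definition step_in (T : R) (p : step_data) :=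
  all (fun i => [&& 0 <= i.2.1, i.2.1 <= i.2.2 & i.2.2 <= T]) p.

Definition step_fun (p : step_data) (x : R) : R :=
  \sum_(i <- p) i.1 * (i.2.1 < x <= i.2.2)%R%:R.

Definition step_int (W : Type) (X : R -> W -> R) (p : step_data) (w : W) : R :=
  \sum_(i <- p) i.1 * (X i.2.2 w - X i.2.1 w).

(* Z is a version of \int_0^T f dX for a deterministic f: the elementary
   integral is extended from step functions to L_2[0,T] by taking its closure
   in L_2[0,T] x L_2(P).  When E (\int f dX)^2 <= c \int f^2 this closure is the
   graph of a bounded operator. *)
Definition is_integral d (W : measurableType d) (P : probability W R)
    (X : R -> W -> R) (T : R) (f : R -> R) (Z : W -> R) :=
  measurable_fun setT Z /\
  exists p : nat -> step_data,
    [/\ forall k, step_in T (p k),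
        (\int[mu]_(x in `[0%R, T]) ((step_fun (p k) x - f x) ^+ 2)%:E)%E
          @[k --> \oo] --> 0%E &
        (\int[P]_w ((step_int X (p k) w - Z w) ^+ 2)%:E)%E
          @[k --> \oo] --> 0%E].

Definition noise_int (n : nat) (Q : probability (skorokhod R n) R)
    (f : R -> R) : skorokhod R n -> R :=
  xget (fun=> 0) [set Z | is_integral Q (@coord_process R n) n%:R f Z].

Definition noise_condition (n : nat) (Q : probability (skorokhod R n) R)
    (sigma : R) :=
  forall f, sq_integrable n%:R f ->
    [/\ is_integral Q (@coord_process R n) n%:R f (noise_int Q f),
        forall Z, is_integral Q (@coord_process R n) n%:R f Z ->
          {ae Q, forall w, (Z w = noise_int Q f w)%R},
        ('E_Q[noise_int Q f] = 0)%E &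
        ('E_Q[fun w => ((noise_int Q f w) ^+ 2)%R] <=
          sigma%:E * \int[mu]_(x in `[0%R, n%:R]) ((f x) ^+ 2)%:E)%E].

End stochastic_integral.

Section observation.
Context {R : realType}.
Notation mu := (@lebesgue_measure R).

Lemma measurable_shift (c : R) :
  measurable_fun [set: measurableTypeR R] (fun x : measurableTypeR R => x + c : measurableTypeR R).
Proof. by apply: measurable_funD => //; exact: measurable_cst. Qed.

Lemma lebesgue_shift (c : R) (A : set R) : measurable A ->
  pushforward mu (fun x : R => x + c) A = mu A.
Proof.
move=> mA.
pose f : {mfun measurableTypeR R >-> measurableTypeR R} :=
  HB.pack (fun x : measurableTypeR R => x + c : measurableTypeR R)
    (isMeasurableFun.Build _ _ _ _ _ (measurable_shift c)).
apply/esym/(@lebesgue_measure_unique R (pushforward mu f)) => // X [[a b] _ <-].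
transitivity (mu `]a - c, b - c]%classic); last first.
  rewrite /pushforward; congr (mu _).
  by apply/seteqP; split => x /=; rewrite !in_itv/=; lra.
rewrite !lebesgue_measure_itv /= !lte_fin ltrBlDr subrK.
by case: ifP => // _; rewrite -!EFinB; congr (_%:E); ring.
Qed.

Lemma ge0_integral_shift (c a b : R) (f : R -> \bar R) :
  measurable_fun setT f -> (forall x, 0 <= f x)%E ->
  (\int[mu]_(x in `[(a + c)%R, (b + c)%R]) f x = \int[mu]_(x in `[a, b]) f (x + c)%R)%E.
Proof.
move=> mf f0.
have E := @ge0_integral_pushforward _ _ _ _ R _ (measurable_shift c) mu `[a + c, b + c]%classic f.
rewrite [RHS](_ : _ = (\int[mu]_(x in (fun x : R => x + c)%R @^-1` `[(a + c)%R, (b + c)%R]) f (x + c)%R)%E); last first.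
  congr (integral _ _ _).
  by apply/seteqP; split => x /=; rewrite !in_itv/= !lerD2r.
rewrite -E//; last by exact: measurable_funTS.
pose g : {mfun measurableTypeR R >-> measurableTypeR R} :=
  HB.pack (fun x : measurableTypeR R => x + c : measurableTypeR R)
    (isMeasurableFun.Build _ _ _ _ _ (measurable_shift c)).
apply: (@eq_measure_integral _ _ _ _ (pushforward mu g)) => A mA _.
exact: esym (lebesgue_shift c mA).
Qed.

Record signal := Signal {
  sig_fun :> R -> R;
  sig_measurable : measurable_fun setT sig_fun;
  sig_periodic : forall x, sig_fun (x + 1) = sig_fun x;
  sig_L2 : (\int[mu]_(x in `[0%R, 1%R]) ((sig_fun x) ^+ 2)%:E < +oo)%E }.

Lemma signal_sq_lty (n : nat) (S : signal) :
  (\int[mu]_(x in `[0%R, n%:R]) ((S x) ^+ 2)%:E < +oo)%E.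
Proof.
have mS2 : measurable_fun setT (fun x => ((S x) ^+ 2)%:E).
  by apply/measurable_EFinP; apply: measurable_funX; exact: sig_measurable.
elim: n => [|n IHn]; first by rewrite set_itv1 integral_set1.
have Sn (m : nat) x : S (x + m%:R) = S x.
  elim: m => [|m IHm]; first by rewrite addr0.
  by rewrite -natr1 addrA sig_periodic.
have -> : `[0%R, n.+1%:R]%classic = `[0%R, n%:R]%classic `|` `]n%:R, n.+1%:R]%classic :> set R.
  by rewrite -itv_bndbnd_setU ?bnd_simp ?ler0n ?ler_nat//.
rewrite ge0_integral_setU//=; first last.
- apply/disj_setPLR => x /=; rewrite !in_itv/= => /andP[_ xn].
  by apply/negP; rewrite negb_and -leNgt xn.
- by move=> x _; rewrite lee_fin sqr_ge0.
- exact: measurable_funTS.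
rewrite lte_add_pinfty//.
apply: (@le_lt_trans _ _ (\int[mu]_(x in `[(0 + n%:R)%R, (1 + n%:R)%R]) ((S x) ^+ 2)%:E)%E).
  apply: ge0_subset_integral => //=.
  - exact: measurable_funTS.
  - by move=> x _; rewrite lee_fin sqr_ge0.
  - move=> x /=; rewrite !in_itv/= add0r -natr1 addrC => /andP[/ltW -> ]; by rewrite addrC.
rewrite ge0_integral_shift//; last by move=> x; rewrite lee_fin sqr_ge0.
under eq_integral do rewrite Sn.
exact: sig_L2.
Qed.

Lemma signal_integrable (n : nat) (S : signal) :
  mu.-integrable `[0, n%:R] (EFin \o S).
Proof.
have mS : measurable_fun setT S by exact: sig_measurable.
have mS2 : measurable_fun setT (fun x => (1 + (S x) ^+ 2)%:E).
  apply/measurable_EFinP; apply: measurable_funD => //.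
  exact: measurable_funX.
apply: (@le_integrable _ _ _ mu _ _ _ (fun x => (1 + (S x) ^+ 2)%:E)) => //.
- by apply/measurable_EFinP; exact: measurable_funTS.
- move=> x _ /=; rewrite lee_fin [leRHS]ger0_norm ?addr_ge0 ?sqr_ge0//.
  have := normr_ge0 (S x); rewrite -(real_normK (num_real (S x))); nra.
apply/integrableP; split; first exact: measurable_funTS.
under eq_integral => x _ do rewrite gee0_abs ?lee_fin ?addr_ge0 ?sqr_ge0// EFinD.
rewrite ge0_integralD//=; last 2 first.
- by move=> x _; rewrite lee_fin sqr_ge0.
- apply/measurable_EFinP/measurable_funTS; exact: measurable_funX.
rewrite lte_add_pinfty//; last exact: signal_sq_lty.
rewrite integral_cst//= mul1e lebesgue_measure_itv/=.
by case: ifP => _; rewrite ?ltry// sube0 ltry.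
Qed.

Definition obs_fun n (S : signal) (xi : skorokhod R n) (t : R) : R :=
  if 0 <= t <= n%:R then \int[mu]_(s in `[0, t]) S s + xi t else 0.

Lemma obs_cadlag n (S : signal) (xi : skorokhod R n) :
  cadlag n%:R (obs_fun S xi).
Proof.
have [xr xl] := sk_cadlag xi.
have [n0|n0] := leqP n 0.
  move: n0 xi xr xl; rewrite leqn0 => /eqP -> xi _ _.
  split=> t /andP[a b]; exfalso.
    by have := le_lt_trans a b; rewrite ltxx.
  by have := lt_le_trans a b; rewrite ltxx.
have n0' : (0 : R) < n%:R by rewrite ltr0n.
have /(continuous_within_itvP _ n0')[ci c0 cn] :=
  parameterized_integral_continuous (ltW n0') (signal_integrable n S).
set J := (fun x : R => parameterized_integral mu 0 x S) in ci c0 cn.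
split=> t /andP[t0 tn].
- have Jt : J x @[x --> t^'+] --> J t.
    have [->//|t0'] := eqVneq t 0.
    apply: cvg_at_right_filter; apply: ci.
    by rewrite in_itv/= lt_neqAle eq_sym t0' t0.
  rewrite {2}/obs_fun t0 (ltW tn)/=.
  apply: cvg_trans (cvgD Jt (xr _ _)); last by rewrite t0.
  apply: near_eq_cvg; near=> x.
  rewrite /obs_fun ifT//; apply/andP; split.
    by rewrite (le_trans t0)// ltW//; near: x; exact: nbhs_right_gt.
  by near: x; exact: nbhs_right_le.
- have Jt : J x @[x --> t^'-] --> J t.
    have [->//|t0'] := eqVneq t n%:R.
    apply: cvg_at_left_filter; apply: ci.
    by rewrite in_itv/= t0/= lt_neqAle t0'.
  have xt : cvg (xi x @[x --> t^'-]) by apply: xl; rewrite t0.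
  apply/cvg_ex; exists (J t + lim (xi x @[x --> t^'-])).
  apply: cvg_trans (cvgD Jt xt).
  apply: near_eq_cvg; near=> x.
  rewrite /obs_fun ifT//; apply/andP; split.
    by near: x; exact: nbhs_left_ge.
  by rewrite (le_trans _ tn)// ltW//; near: x; exact: nbhs_left_lt.
Unshelve. all: by end_near. Qed.

Lemma obs_out n (S : signal) (xi : skorokhod R n) (t : R) :
  ~~ (0 <= t <= n%:R) -> obs_fun S xi t = 0.
Proof. by rewrite /obs_fun => /negbTE ->. Qed.

Definition obs n (S : signal) (xi : skorokhod R n) : skorokhod R n :=
  Skorokhod (obs_cadlag S xi) (@obs_out n S xi).

Lemma measurable_obs n (S : signal) : measurable_fun setT (@obs n S).
Proof.
apply: (@measurability _ _ _ _ _ _ (@evaluation_sets R n)) => // _ [_ [t [B [mB ->]]] <-].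
rewrite setTI.
pose c := \int[mu]_(s in `[0, t]) S s.
have mC : measurable ((fun x : measurableTypeR R => x + c) @^-1` B).
  by rewrite -[X in measurable X]setTI; exact: measurable_shift.
have [tn|tn] := boolP (0 <= t <= n%:R).
  apply: sub_sigma_algebra; exists t, ((fun x => x + c) @^-1` B); split => //.
  by apply/seteqP; split => f; rewrite /= /obs_fun tn addrC.
rewrite (_ : _ @^-1` _ = [set f : skorokhod R n | B 0]).
  have [b|b] := pselect (B 0).
    by rewrite (_ : [set _ | _] = setT)//; apply/seteqP; split.
  by rewrite (_ : [set _ | _] = set0)//; apply/seteqP; split.
by apply/seteqP; split => f; rewrite /= /obs_fun (negbTE tn).
Qed.

HB.instance Definition _ n (S : signal) :=
  isMeasurableFun.Build _ _ _ _ (@obs n S) (@measurable_obs n S).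

Definition obs_law n (Q : probability (skorokhod R n) R) (S : signal) :
  probability (skorokhod R n) R := distribution Q (@obs n S).

End observation.
Arguments signal : clear implicits.

Section model_selection.
Context {R : realType} (n : nat).
Notation mu := (@lebesgue_measure R).
Notation D := (skorokhod R n).
Implicit Types (Q : probability D R) (QQ : set (probability D R)).

Definition risk Q (S : signal R) (est : D -> R -> R) : \bar R :=
  (\int[obs_law Q S]_y \int[mu]_(t in `[0%R, 1%R]) ((est y t - S t) ^+ 2)%:E)%E.

Definition robust_risk QQ (S : signal R) (est : D -> R -> R) : \bar R :=
  ereal_sup [set risk Q S est | Q in QQ].

(* Sequences (x_j)_(j >= 1) are functions on nat whose value at 0 is unused. *)
Definition phi (j : nat) (x : R) : R :=
  if j == 1%N then 1
  else if odd j then Num.sqrt 2 * sin (2 * pi * (j./2)%:R * x)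
  else Num.sqrt 2 * cos (2 * pi * (j./2)%:R * x).

Definition sqnorm (x : nat -> R) : R := \sum_(1 <= j <oo) (x j) ^+ 2.

Definition nsupp (x : nat -> R) : \bar R :=
  (\sum_(1 <= j <oo) ((0 < `|x j|)%R%:R)%:E)%E.

Definition noise_coef Q (j : nat) (w : D) : R :=
  (Num.sqrt n%:R)^-1 * noise_int Q (phi j) w.

Definition noise_var Q (j : nat) : R :=
  fine ('E_Q[fun w => ((noise_coef Q j w) ^+ 2)%R])%E.

Definition L1 (varsigma : R) Q : \bar R :=
  ereal_sup [set (`|\sum_(1 <= j <oo) x j * (noise_var Q j - varsigma)|)%:E |
    x in [set x : nat -> R | (forall j, -1 <= x j <= 1) /\
                             (nsupp x <= n%:R%:E)%E]].

Definition L2 Q : \bar R :=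
  ereal_sup [set ('E_Q[fun w => ((\sum_(1 <= j <oo)
      x j * ((noise_coef Q j w) ^+ 2 - noise_var Q j)) ^+ 2)%R])%E |
    x in [set x : nat -> R | sqnorm x <= 1 /\ (nsupp x <= n%:R%:E)%E]].

Section estimators.
Variables (theta : nat -> D -> R) (sighat : D -> R) (rho : R).

Definition wls_estimator (g : nat -> R) (y : D) (t : R) : R :=
  \sum_(1 <= j <oo) g j * theta j y * phi j t.

Definition theta2 (j : nat) (y : D) : R := (theta j y) ^+ 2 - sighat y / n%:R.

Definition penalty (g : nat -> R) (y : D) : R := sighat y * sqnorm g / n%:R.

Definition cost (g : nat -> R) (y : D) : R :=
  \sum_(1 <= j <oo) (g j) ^+ 2 * (theta j y) ^+ 2
  - 2 * \sum_(1 <= j <oo) g j * theta2 j y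
  + rho * penalty g y.

(* A measurable selection of a minimizer of the cost over Gamma. *)
Definition cost_minimizer (Gamma : {fset nat -> R}) (ghat : D -> nat -> R) :=
  [/\ forall y, ghat y \in Gamma,
      forall y g, g \in Gamma -> cost (ghat y) y <= cost g y &
      forall g, g \in Gamma -> measurable [set y | ghat y = g]].

Definition selected_estimator (ghat : D -> nat -> R) (y : D) : R -> R :=
  wls_estimator (ghat y) y.

End estimators.

Definition var_error QQ (varsigma : probability D R -> R) (S : signal R)
    (sighat : D -> R) : \bar R :=
  ereal_sup [set ('E_(obs_law Q S)[fun y => `|sighat y - varsigma Q|%R])%E |
    Q in QQ].

Definition max_supp (Gamma : {fset nat -> R}) : \bar R :=
  \big[maxe/0%E]_(g <- Gamma) nsupp g.

Definition Psi_star (vlo vhi shi nu ln rho : R) : R :=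
  (2 * vhi * shi * nu + 4 * vhi * ln + 2 * nu * ln) /
  (vlo * rho * (1 - 3 * rho)).

Definition B_star QQ (sigma varsigma : probability D R -> R) (ln : R)
    (Gamma : {fset nat -> R}) (S : signal R) (sighat : D -> R) (rho : R)
    : \bar R :=
  ((Psi_star (inf (varsigma @` QQ)) (sup (varsigma @` QQ)) (sup (sigma @` QQ))
     (#|` Gamma|)%:R ln rho)%:E
   + (6 / (1 - 3 * rho))%:E * max_supp Gamma
     * var_error QQ varsigma S sighat)%E.

End model_selection.

(* Main.v *)
Require Import Defs.
From HB Require Import structures.
From mathcomp Require Import all_boot all_order all_algebra finmap.
From mathcomp Require Import all_classical all_reals all_analysis.
From mathcomp Require Import ring lra measurable_realfun.
Set Implicit Arguments.
Unset Strict Implicit.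
Unset Printing Implicit Defensive.
Import Order.TTheory GRing.Theory Num.Theory.
Import numFieldNormedType.Exports.
Local Open Scope classical_set_scope.
Local Open Scope ring_scope.

(** Write [h j] for the estimated Fourier coefficients, [t j] for those of [S],
and [x j = h j - t j].  By uniqueness of the stochastic integral, [x j] is
[xi_j / sqrt n] almost surely ([is_integral_obs], [noise_int_phi]): the
observed integral of [phi j] is the integral of [phi j] against the noise plus
the integral of [phi j * S].  Since the [phi j] are orthonormal
([phi_orthonormal]), the loss of a weighted estimator is a quadratic
polynomial in the [h j] ([integral_loss]).

The loss of a weight sequence [g] exceeds its cost by the constant [|S|^2],
minus the penalty, plus twice the sum of four terms ([seq_loss_cost]): a
linear fluctuation [sum g t x], a centred quadratic fluctuation
[sum g (x^2 - E x^2)], a bias [sum g (E x^2 - varsigma / n)], and the error of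
the variance estimator.  Compare the selected [g] with a fixed [g0] at which
the cost is at least as large.

- The bias is bounded by [L1], and the variance error by the support size.
- Young's inequality bounds the quadratic fluctuation by
  [rho * varsigma * |g|^2 / n], which the penalty of [g] absorbs, plus a
  square whose mean is controlled by [L2].
- For [d = g - g0], the linear fluctuation [sum d t x] has variance of order
  [D = sum d^2 t^2].  Young's inequality leaves [rho * D], and [D] is
  replaced by the energy [sum d^2 h^2] of the difference of the two
  estimators at the price of one more linear fluctuation [sum d^2 t x].
  That energy is at most twice the sum of the two losses, which is why the
  selected loss comes out with the factor [1 - 3 * rho]
  ([lin_fluct_bound], [seq_oracle]).

The squares that remain depend on the random selected weights; they are
nonnegative, so each is at most its sum over [Gamma], and their means produce
the factor [nu] ([mean_oracle]).  The term [rho * varsigma * |g0|^2 / n] is at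
most the mean loss of [g0] up to [L1], because a mean loss is at least its
variance part ([loss_lower_bound]).  The bound obtained for each [Q] is
monotone in the quantities over which the theorem takes suprema and infima. *)

(** * Square-integrable functions *)

Section square_integrable_functions.
Context d (T : measurableType d) (R : realType).
Variables (m : {measure set T -> \bar R}) (D : set T) (mD : measurable D).
Implicit Types f g : T -> R.

Definition sqint f :=
  measurable_fun D f /\ (\int[m]_(x in D) ((f x) ^+ 2)%:E < +oo)%E.

Lemma sqint_integrable_sqr f : sqint f -> m.-integrable D (fun x => ((f x) ^+ 2)%:E).
Proof.
move=> [mf fi]; apply/integrableP; split.
  by apply/measurable_EFinP; exact: measurable_funX.
by under eq_integral => x _ do rewrite gee0_abs ?lee_fin ?sqr_ge0//.
Qed.

Lemma sqint_integrableM f g : sqint f -> sqint g ->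
  m.-integrable D (fun x => (f x * g x)%:E).
Proof.
move=> sf sg.
have := integrableD mD (sqint_integrable_sqr sf) (sqint_integrable_sqr sg).
apply: le_integrable => //.
  by apply/measurable_EFinP; apply: measurable_funM; [case: sf|case: sg].
move=> x _ /=; rewrite lee_fin.
rewrite [leRHS]ger0_norm ?addr_ge0 ?sqr_ge0// ler_norml; apply/andP; split.
  by have := sqr_ge0 (f x + g x); have := sqr_ge0 (f x - g x); lra.
by have := sqr_ge0 (f x - g x); have := sqr_ge0 (f x + g x); lra.
Qed.

Lemma sqintDZ f g (c : R) : sqint f -> sqint g -> sqint (fun x => f x + c * g x).
Proof.
move=> sf sg; have [mf fi] := sf; have [mg gi] := sg.
split; first by apply: measurable_funD => //; apply: measurable_funM.
have i1 := sqint_integrable_sqr sf.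
have i2 := integrableZl mD (2 * c) (sqint_integrableM sf sg).
have i3 := integrableZl mD (c ^+ 2) (sqint_integrable_sqr sg).
have /integrableP[_] := integrableD mD i1 (integrableD mD i2 i3).
congr (_ < _)%E; apply: eq_integral => x _ /=.
rewrite ger0_norm; first by congr _%:E; ring.
rewrite [X in 0 <= X](_ : _ = (f x + c * g x) ^+ 2); first exact: sqr_ge0.
by ring.
Qed.

Lemma sqint_sum (r : seq nat) (c : nat -> R) (h : nat -> T -> R) :
  (forall j, sqint (h j)) -> sqint (fun x => \sum_(j <- r) c j * h j x).
Proof.
move=> sh; elim: r => [|j r IH].
  split; first by under eq_fun do rewrite big_nil; exact: measurable_cst.
  under eq_integral do rewrite big_nil expr0n/=.
  by rewrite integral0 ltry.
have := sqintDZ (c j) IH (sh j).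
by under [X in _ -> sqint X]eq_fun do rewrite big_cons addrC.
Qed.

Local Notation "'int' f" := (Rintegral m D f) (at level 10).

Lemma Rintegral_sqrD f g (c : R) : sqint f -> sqint g ->
  int (fun x => (f x + c * g x) ^+ 2) =
    int (fun x => f x ^+ 2) + 2 * c * int (fun x => f x * g x)
    + c ^+ 2 * int (fun x => g x ^+ 2).
Proof.
move=> sf sg.
have i1 := sqint_integrable_sqr sf.
have i2 := sqint_integrableM sf sg.
have i3 := sqint_integrable_sqr sg.
have j2 := integrableZl mD (2 * c) i2; have j3 := integrableZl mD (c ^+ 2) i3.
rewrite -RintegralZl// -RintegralZl// -RintegralD// -RintegralD//; last first.
  exact: (integrableD mD i1 j2).
by apply: eq_Rintegral => x _; ring.
Qed.

(** The polynomial [c |-> int (f + c g)^2] is nonnegative, so its discriminant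
is not positive. *)
Lemma cauchy_schwarz f g : sqint f -> sqint g ->
  (int (fun x => f x * g x)) ^+ 2 <= int (fun x => f x ^+ 2) * int (fun x => g x ^+ 2).
Proof.
move=> sf sg.
have H c : 0 <= int (fun x => f x ^+ 2) + 2 * c * int (fun x => f x * g x)
    + c ^+ 2 * int (fun x => g x ^+ 2).
  by rewrite -Rintegral_sqrD//; apply: Rintegral_ge0 => x _; exact: sqr_ge0.
have : 0 <= int (fun x => g x ^+ 2) by apply: Rintegral_ge0 => x _; exact: sqr_ge0.
have : 0 <= int (fun x => f x ^+ 2) by apply: Rintegral_ge0 => x _; exact: sqr_ge0.
move: H.
set A := int (fun x => f x ^+ 2); set C := int (fun x => g x ^+ 2).
set B := int (fun x => f x * g x).
move: A B C => A B C H A0 C0.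
have [Cz|Cnz] := eqVneq C 0.
  have [->|Bnz] := eqVneq B 0; first by rewrite expr0n/= mulr_ge0.
  (* The affine function A + 2 c B takes the value -1 at this c. *)
  have := H (- (A + 1) / (2 * B)); rewrite Cz mulr0 addr0.
  rewrite [X in 0 <= A + X](_ : _ = - (A + 1)); last by field; rewrite Bnz.
  lra.
have Cp : 0 < C by rewrite lt_neqAle eq_sym Cnz.
have := mulr_ge0 C0 (H (- B / C)).
rewrite [X in 0 <= X](_ : _ = A * C - B ^+ 2); last by field.
lra.
Qed.

Lemma Rintegral_sum (r : seq nat) (h : nat -> T -> R) :
  (forall j, m.-integrable D (EFin \o h j)) ->
  int (fun x => \sum_(j <- r) h j x) = \sum_(j <- r) int (h j).
Proof.
move=> ih; elim: r => [|j r IH].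
  under eq_Rintegral do rewrite big_nil.
  by rewrite big_nil Rintegral_cst// mul0r.
under eq_Rintegral do rewrite big_cons.
rewrite RintegralD//; first by rewrite big_cons IH.
rewrite (_ : EFin \o _ = (fun x => \sum_(j <- r) (EFin \o h j) x)%E).
  exact: integrable_sum.
by apply/funext => x /=; rewrite sumEFin.
Qed.

End square_integrable_functions.

(** Since [(u + c v)^2 <= 2 u^2 + 2 c^2 v^2], the approximations that define
[is_integral] can be combined linearly, both in [L2[0, T]] and in [L2(P)]. *)
Lemma cvg_sqintDZ d (T : measurableType d) (R : realType)
    (m : {measure set T -> \bar R}) (D : set T) (mD : measurable D)
    (u v : nat -> T -> R) (c : R) :
  (forall k, measurable_fun D (u k)) -> (forall k, measurable_fun D (v k)) ->
  (\int[m]_(x in D) ((u k x) ^+ 2)%:E)%E @[k --> \oo] --> 0%E ->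
  (\int[m]_(x in D) ((v k x) ^+ 2)%:E)%E @[k --> \oo] --> 0%E ->
  (\int[m]_(x in D) ((u k x + c * v k x) ^+ 2)%:E)%E @[k --> \oo] --> 0%E.
Proof.
move=> mu mv u0 v0.
have mu2 k : measurable_fun D (fun x => (u k x ^+ 2)%:E).
  by apply/measurable_EFinP; exact: measurable_funX.
have mv2 k : measurable_fun D (fun x => (v k x ^+ 2)%:E).
  by apply/measurable_EFinP; exact: measurable_funX.
have H : ((2%:E * \int[m]_(x in D) ((u k x) ^+ 2)%:E
    + (2 * c ^+ 2)%:E * \int[m]_(x in D) ((v k x) ^+ 2)%:E)%E @[k --> \oo] --> 0%E).
  rewrite -[X in _ --> X](_ : (2%:E * 0 + (2 * c ^+ 2)%:E * 0 = 0)%E); last first.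
    by rewrite !mule0 adde0.
  apply: cvgeD; first by rewrite !mule0.
    by apply: cvgeZl.
  by apply: cvgeZl.
apply: (@squeeze_cvge _ _ _ _ (fun=> 0%E) _ _ _ _ (cvg_cst _) H).
near=> k; apply/andP; split.
  by apply: integral_ge0 => x _; rewrite lee_fin sqr_ge0.
rewrite -ge0_integralZl_EFin//; last by move=> x _; rewrite lee_fin sqr_ge0.
rewrite -ge0_integralZl_EFin//; [|by move=> x _; rewrite lee_fin sqr_ge0|by rewrite mulr_ge0// sqr_ge0].
rewrite -ge0_integralD//.
- apply: ge0_le_integral => //.
  + by move=> x _; rewrite lee_fin sqr_ge0.
  + apply/measurable_EFinP; apply: measurable_funX; apply: measurable_funD => //.
    exact: measurable_funM.
  + apply: emeasurable_funD; exact: measurable_funeM.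
  + move=> x _; rewrite -!EFinM -EFinD lee_fin.
    have := sqr_ge0 (u k x - c * v k x); lra.
- by move=> x _; rewrite -EFinM lee_fin mulr_ge0// sqr_ge0.
- exact: measurable_funeM.
- by move=> x _; rewrite -EFinM lee_fin mulr_ge0 ?sqr_ge0// mulr_ge0// sqr_ge0.
- exact: measurable_funeM.
Unshelve. all: by end_near. Qed.

(** * The trigonometric basis *)

Section trigonometric_basis.
Context {R : realType}.
Notation mu := (@lebesgue_measure R).

Lemma continuous_affine_cos (w c : R) : continuous (fun x => cos (w * x + c)).
Proof.
move=> x; apply: continuous_comp; last exact: continuous_cos.
by apply: cvgD; [apply: cvgM; [exact: cvg_cst|exact: cvg_id]|exact: cvg_cst].
Qed.

Lemma is_derive_affine_sin (w c x : R) :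
  is_derive x 1 (fun x => sin (w * x + c)) (w * cos (w * x + c)).
Proof.
have d1 : is_derive x 1 (fun x : R => w * x + c) w.
  have := is_deriveD (is_deriveZ w (is_derive_id x (1 : R))) (is_derive_cst c x 1).
  by move/is_derive_eq; apply; rewrite addr0 /GRing.scale/= mulr1.
apply: (is_derive_eq (is_derive1_comp (is_derive_sin _) d1)).
by rewrite /GRing.scale/= mulrC.
Qed.

Lemma integral_affine_cos (w c : R) : w != 0 ->
  \int[mu]_(x in `[0, 1]) cos (w * x + c) = (sin (w + c) - sin c) / w.
Proof.
move=> w0; rewrite /Rintegral.
pose F x := w^-1 * sin (w * x + c).
have dF (x : R) : is_derive x (1 : R) F (cos (w * x + c)).
  have := is_deriveZ w^-1 (is_derive_affine_sin w c x).
  by move/is_derive_eq; apply; rewrite /GRing.scale/= mulrA mulVf// mul1r.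
have cF : continuous F.
  by move=> x; apply/differentiable_continuous/derivable1_diffP; case: (dF x).
rewrite (@continuous_FTC2 _ _ F)//.
- rewrite /F mulr1 mulr0 add0r /= -mulrBr mulrC; congr (_ * _).
- by apply: continuous_subspaceT; exact: continuous_affine_cos.
- split.
  + by move=> x _; case: (dF x).
  + by apply: cvg_at_right_filter; exact: cF.
  + by apply: cvg_at_left_filter; exact: cF.
- by move=> x _; rewrite derive1E; case: (dF x).
Qed.

Lemma sinD2pin (x : R) (k : nat) : sin (x + 2 * pi * k%:R) = sin x.
Proof.
by rewrite -(periodicn (@sinD2pi R) k x); congr sin; rewrite -mulr_natr -[pi *+ 2]mulr_natr; ring.
Qed.

Lemma sinB2pin (x : R) (k l : nat) : sin (2 * pi * (k%:R - l%:R) + x) = sin x.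
Proof.
by rewrite -(sinD2pin _ l) -[RHS](sinD2pin x k); congr sin; ring.
Qed.

(** A sine is a cosine delayed by a quarter of a period: with this phase, the
cosines and the sines of the basis obey a single product formula. *)
Definition phase (j : nat) : R := if odd j then - (pi / 2) else 0.

Lemma phiE (j : nat) (x : R) : j != 1%N ->
  phi j x = Num.sqrt 2 * cos (2 * pi * (j./2)%:R * x + phase j).
Proof.
move=> /negbTE j1; rewrite /phi j1 /phase; case: ifP => _.
  by rewrite cosD cosN sinN cos_pihalf sin_pihalf; congr (_ * _); ring.
by rewrite addr0.
Qed.

Lemma continuous_phi (j : nat) : continuous (@phi R j).
Proof.
have [->|j1] := eqVneq j 1%N.
  by rewrite (_ : phi 1 = cst 1)//; exact: cst_continuous.
rewrite (_ : phi j = (fun x => Num.sqrt 2 * cos (2 * pi * (j./2)%:R * x + phase j))).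
  move=> x; apply: cvgM; [exact: cvg_cst|exact: continuous_affine_cos].
by apply/funext => x; rewrite phiE.
Qed.

Lemma measurable_phi (j : nat) : measurable_fun setT (@phi R j).
Proof. exact: continuous_measurable_fun (@continuous_phi j). Qed.

Lemma phi_sqr_le2 (j : nat) (x : R) : (phi j x) ^+ 2 <= 2.
Proof.
have [->|j1] := eqVneq j 1%N; first by rewrite /phi/= expr1n ler1n.
rewrite phiE// exprMn sqr_sqrtr// ler_piMr//.
Qed.

Lemma sqint_phi (b : R) (j : nat) : sqint mu `[0, b] (phi j).
Proof.
split; first exact: measurable_funTS (measurable_phi j).
apply: (@le_lt_trans _ _ (\int[mu]_(x in `[0%R, b]) (cst 2%:E x))%E).
  apply: ge0_le_integral => //.
  - by move=> x _; rewrite lee_fin sqr_ge0.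
  - apply/measurable_EFinP; apply: measurable_funX.
    exact: measurable_funTS (measurable_phi j).
  - by move=> x _; rewrite lee_fin phi_sqr_le2.
rewrite integral_cst//= lebesgue_measure_itv/=.
by case: ifP => _; rewrite ?mule0 ?ltry// -EFinB -EFinM ltry.
Qed.

Lemma phi_periodic (j : nat) (x : R) : phi j (x + 1) = phi j x.
Proof.
have [->//|j1] := eqVneq j 1%N.
rewrite !phiE//; congr (_ * _).
rewrite -!sinDpihalf -[RHS](sinD2pin _ j./2); congr sin; ring.
Qed.

Lemma prod_phi (i j : nat) (x : R) : i != 1%N -> j != 1%N ->
  phi i x * phi j x =
    cos (2 * pi * ((i./2)%:R + (j./2)%:R) * x + (phase i + phase j))
    + cos (2 * pi * ((i./2)%:R - (j./2)%:R) * x + (phase i - phase j)).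
Proof.
move=> i1 j1; rewrite !phiE//.
set a := 2 * pi * i./2%:R * x + phase i; set b := 2 * pi * j./2%:R * x + phase j.
rewrite (_ : 2 * pi * (_ + _) * x + _ = a + b); last by rewrite /a /b; ring.
rewrite (_ : 2 * pi * (_ - _) * x + _ = a - b); last by rewrite /a /b; ring.
rewrite (cosD a b) cosB mulrACA -expr2 sqr_sqrtr//; ring.
Qed.

Lemma integrable_affine_cos (w c : R) :
  mu.-integrable `[0, 1] (EFin \o (fun x => cos (w * x + c))).
Proof.
apply: measurable_bounded_integrable => //.
- by rewrite /= lebesgue_measure_itv/= lte_fin ltr01 sube0 ltry.
- by apply: measurable_funTS; apply: continuous_measurable_fun; exact: continuous_affine_cos.
- exists 1; split => // M M1 x _ /=.
  by rewrite ler_norml (le_trans (cos_le1 _) (ltW M1)) andbT (le_trans _ (cos_geN1 _))// lerN2 ltW.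
Qed.

(** The product of two basis functions is a sum of two cosines, whose
frequencies are the sum and the difference of theirs.  A nonzero integer
frequency integrates to 0, so only equal frequencies contribute, and then
opposite parities leave the cosine of a right angle. *)
Lemma phi_orthonormal (i j : nat) : (0 < i)%N -> (0 < j)%N ->
  \int[mu]_(x in `[0, 1]) (phi i x * phi j x) = (i == j)%:R.
Proof.
have int1 : \int[mu]_(x in `[0, 1]) (1 : R) = 1.
  by rewrite Rintegral_cst//= lebesgue_measure_itv/= lte_fin ltr01 sube0 mul1r.
have pin0 : pi != 0 :> R by rewrite gt_eqF// pi_gt0.
have half_gt0 k : (0 < k)%N -> k != 1%N -> (0 < k./2)%N by case: k => [|[|k]].
have phi1j k : (0 < k)%N -> k != 1%N -> \int[mu]_(x in `[0, 1]) phi k x = 0.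
  move=> k0 k1; under eq_Rintegral do rewrite phiE//.
  rewrite RintegralZl//; last exact: integrable_affine_cos.
  rewrite integral_affine_cos ?sinD2pin; last first.
    by rewrite !mulf_neq0// pnatr_eq0 -lt0n half_gt0.
  by rewrite [2 * pi * _ + _]addrC sinD2pin subrr mul0r mulr0.
move=> i0 j0; have [->|i1] := eqVneq i 1%N.
  under eq_Rintegral do rewrite mul1r.
  have [->|j1] := eqVneq j 1%N; first by rewrite /phi/= int1.
  by rewrite phi1j// eq_sym (negbTE j1).
have [->|j1] := eqVneq j 1%N.
  under eq_Rintegral do rewrite mulr1.
  by rewrite phi1j// (negbTE i1).
under eq_Rintegral do rewrite prod_phi//.
rewrite RintegralD//; [|exact: integrable_affine_cos..].
rewrite integral_affine_cos; last first.
  by rewrite -natrD !mulf_neq0// pnatr_eq0 -lt0n addn_gt0 half_gt0.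
rewrite -natrD [2 * pi * _ + _]addrC sinD2pin subrr mul0r add0r.
have [hij|hij] := eqVneq i./2 j./2; last first.
  rewrite integral_affine_cos ?sinB2pin ?subrr ?mul0r; last first.
    by rewrite !mulf_neq0// subr_eq0 eqr_nat.
  by case: (eqVneq i j) hij => // ->; rewrite eqxx.
under eq_Rintegral do rewrite hij subrr mulr0 mul0r add0r.
rewrite Rintegral_cst//= lebesgue_measure_itv/= lte_fin ltr01 sube0 mulr1.
have -> : (i == j) = (odd i == odd j).
  apply/eqP/eqP => [->//|oij].
  by rewrite -(odd_double_half i) -(odd_double_half j) oij hij.
rewrite /phase; case: (odd i); case: (odd j) => /=.
- by rewrite subrr cos0.
- by rewrite subr0 cosN cos_pihalf.
- by rewrite sub0r opprK cos_pihalf.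
- by rewrite subr0 cos0.
Qed.

(** The nonnegative case follows by cutting the interval into unit pieces and
shifting them; the general case by taking positive and negative parts. *)
Lemma integral_periodic (f : R -> R) (m : nat) :
  measurable_fun setT f -> (forall x, f (x + 1) = f x) ->
  mu.-integrable `[0, 1] (EFin \o f) ->
  \int[mu]_(x in `[0, m%:R]) f x = m%:R * \int[mu]_(x in `[0, 1]) f x.
Proof.
move=> mf pf.
have fD (k : nat) x : f (x + k%:R) = f x.
  elim: k => [|k IH]; first by rewrite addr0.
  by rewrite -natr1 addrA pf.
have pieces (g : R -> \bar R) : measurable_fun setT g -> (forall x, 0 <= g x)%E ->
    (forall (k : nat) x, g (x + k%:R) = g x) ->
    (\int[mu]_(x in `[0%R, m%:R]) g x = m%:R%:E * \int[mu]_(x in `[0%R, 1%R]) g x)%E.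
  move=> mg g0 gD; elim: m => [|k IH]; first by rewrite set_itv1 integral_set1 mul0e.
  have -> : `[0%R, k.+1%:R]%classic = `[0%R, k%:R]%classic `|` `]k%:R, k.+1%:R]%classic :> set R.
    by rewrite -itv_bndbnd_setU ?bnd_simp ?ler0n ?ler_nat//.
  rewrite ge0_integral_setU//=; first last.
  - apply/disj_setPLR => x /=; rewrite !in_itv/= => /andP[_ xn].
    by apply/negP; rewrite negb_and -leNgt xn.
  - exact: measurable_funTS.
  rewrite integral_itv_obnd_cbnd; last exact: measurable_funTS.
  have := ge0_integral_shift k%:R 0 1 mg g0.
  rewrite add0r nat1r => ->.
  under [X in (_ + X)%E]eq_integral do rewrite gD.
  by rewrite IH -natr1 EFinD ge0_muleDl ?mul1e ?lee_fin//.
move=> fi; rewrite /Rintegral integralE [in RHS]integralE.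
have mef : measurable_fun setT (EFin \o f) by exact/measurable_EFinP.
rewrite (pieces ((EFin \o f)^\+)%E); first last.
- by move=> k x; rewrite !funeposE/= fD.
- by move=> x; exact: funepos_ge0.
- exact: measurable_funepos.
rewrite (pieces ((EFin \o f)^\-)%E); first last.
- by move=> k x; rewrite !funenegE/= fD.
- by move=> x; exact: funeneg_ge0.
- exact: measurable_funeneg.
have pfin := integrable_pos_fin_num _ fi; have nfin := integrable_neg_fin_num _ fi.
rewrite -muleBr//; last by apply: fin_num_adde_defl; rewrite fin_numN; exact: nfin.
rewrite fineM// fin_numB; apply/andP; split; [exact: pfin|exact: nfin].
Qed.

End trigonometric_basis.

(** * Trigonometric sums and the quadratic loss *)

Section trigonometric_sums.
Context {R : realType}.
Notation mu := (@lebesgue_measure R).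
Implicit Types (r : seq nat) (c : nat -> R) (S : signal R).

Definition fourier_coef S (j : nat) : R :=
  \int[mu]_(x in `[0, 1]) (phi j x * S x).

Lemma sqint_signal (m : nat) S : sqint mu `[0, m%:R] S.
Proof.
split; last exact: signal_sq_lty.
exact: measurable_funTS (sig_measurable S).
Qed.

Definition trig_sum r c (x : R) : R := \sum_(j <- r) c j * phi j x.

Lemma sqint_trig_sum (b : R) r c : sqint mu `[0, b] (trig_sum r c).
Proof. by apply: sqint_sum => // j; exact: sqint_phi. Qed.

Lemma Rintegral_trig_sumM r c (f : R -> R) : sqint mu `[0, 1] f ->
  \int[mu]_(x in `[0, 1]) (trig_sum r c x * f x) =
    \sum_(j <- r) c j * \int[mu]_(x in `[0, 1]) (phi j x * f x).
Proof.
move=> sf.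
have ip j : mu.-integrable `[0, 1] (fun x => (phi j x * f x)%:E).
  by apply: sqint_integrableM => //; exact: sqint_phi.
rewrite (@eq_Rintegral _ _ _ mu _ (fun x => \sum_(j <- r) c j * (phi j x * f x))); last first.
  by move=> x _; rewrite /trig_sum mulr_suml; apply: eq_bigr => j _; rewrite mulrA.
rewrite Rintegral_sum//.
  by apply: eq_bigr => j _; rewrite RintegralZl//; exact: ip.
by move=> j; apply: (integrableZl _ (c j) (ip j)).
Qed.

Lemma Rintegral_trig_sum_sqr r c : uniq r -> all (leq 1) r ->
  \int[mu]_(x in `[0, 1]) (trig_sum r c x ^+ 2) = \sum_(j <- r) (c j) ^+ 2.
Proof.
move=> ur r0.
rewrite Rintegral_trig_sumM; last exact: sqint_trig_sum.
rewrite !big_seq; apply: eq_bigr => i ir; rewrite expr2; congr (_ * _).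
under eq_Rintegral do rewrite mulrC.
rewrite Rintegral_trig_sumM; last exact: sqint_phi.
rewrite (bigD1_seq i)//= phi_orthonormal ?eqxx ?(allP r0)// mulr1.
rewrite big_seq_cond big1 ?addr0// => j /andP[jr ji].
by rewrite phi_orthonormal ?(allP r0)// (negbTE ji) mulr0.
Qed.

Lemma measurable_trig_sum r c : measurable_fun setT (trig_sum r c).
Proof.
by apply: measurable_sum => j; apply: measurable_funM => //; exact: measurable_phi.
Qed.

Lemma integral_trig_sum_sqr (m : nat) r c : uniq r -> all (leq 1) r ->
  (\int[mu]_(x in `[0%R, m%:R]) ((trig_sum r c x) ^+ 2)%:E =
     (m%:R * \sum_(j <- r) (c j) ^+ 2)%:E)%E.
Proof.
move=> ur r0.
rewrite -Rintegral_trig_sum_sqr// -integral_periodic.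
- rewrite fineK//; apply: integrable_fin_num => //.
  exact: sqint_integrable_sqr (sqint_trig_sum _ _ _).
- exact: measurable_funX (measurable_trig_sum r c).
- move=> x; congr (_ ^+ 2); apply: eq_bigr => j _; by rewrite phi_periodic.
- exact: sqint_integrable_sqr (sqint_trig_sum _ _ _).
Qed.

Lemma integral_phi_signal (m : nat) S (j : nat) :
  \int[mu]_(x in `[0, m%:R]) (phi j x * S x) = m%:R * fourier_coef S j.
Proof.
rewrite integral_periodic//.
- by apply: measurable_funM; [exact: measurable_phi|exact: sig_measurable].
- by move=> x; rewrite phi_periodic sig_periodic.
- apply: sqint_integrableM => //; first exact: sqint_phi.
  exact: (sqint_signal 1).
Qed.

Definition sqr_norm S : R := \int[mu]_(x in `[0, 1]) (S x ^+ 2).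

(** Orthonormality turns the loss in [L2[0, 1]] into a polynomial in the
coefficients. *)
Lemma integral_loss r c S : uniq r -> all (leq 1) r ->
  (\int[mu]_(x in `[0%R, 1%R]) ((trig_sum r c x - S x) ^+ 2)%:E =
    (\sum_(j <- r) (c j) ^+ 2 - 2 * \sum_(j <- r) c j * fourier_coef S j
     + sqr_norm S)%:E)%E.
Proof.
move=> ur r0; have s1 := sqint_trig_sum 1 r c; have s2 := sqint_signal 1 S.
have -> : \sum_(j <- r) c j ^+ 2 - 2 * (\sum_(j <- r) c j * fourier_coef S j) + sqr_norm S
   = \int[mu]_(x in `[0, 1]) ((trig_sum r c x + -1 * S x) ^+ 2).
  rewrite Rintegral_sqrD// Rintegral_trig_sum_sqr// Rintegral_trig_sumM//.
  rewrite /sqr_norm; ring.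
rewrite /Rintegral fineK; first by apply: eq_integral => x _; rewrite mulN1r.
apply: integrable_fin_num => //.
exact: sqint_integrable_sqr (sqintDZ _ _ s1 s2).
Qed.

(** Bessel's inequality: the loss of the projection of [S] is nonnegative. *)
Lemma bessel r S : uniq r -> all (leq 1) r ->
  \sum_(j <- r) (fourier_coef S j) ^+ 2 <= sqr_norm S.
Proof.
move=> ur r0.
have := @integral_loss r (fourier_coef S) S ur r0.
set e := (X in X%:E) => eE.
have : 0 <= e.
  by rewrite -lee_fin -eE; apply: integral_ge0 => x _; rewrite lee_fin sqr_ge0.
rewrite /e; under [X in 2 * X]eq_bigr do rewrite -expr2.
lra.
Qed.

End trigonometric_sums.

(** * Stochastic integrals of the noise and of the observation *)

Section wiener_type_integrals.
Context {R : realType}.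
Notation mu := (@lebesgue_measure R).

Lemma measurable_coord (n : nat) (t : R) :
  measurable_fun setT (@coord_process R n t).
Proof.
move=> _ B mB; rewrite setTI; apply: sub_sigma_algebra.
by exists t, B; split.
Qed.

Lemma measurable_step_int d (W : measurableType d) (X : R -> W -> R) (p : step_data) :
  (forall t, measurable_fun setT (X t)) -> measurable_fun setT (step_int X p).
Proof.
move=> mX; apply: measurable_sum => i; apply: measurable_funM => //.
exact: measurable_funB.
Qed.

Lemma step_fun_indic (p : @step_data R) (x : R) :
  step_fun p x = \sum_(i <- p) i.1 * \1_(`]i.2.1, i.2.2]%classic) x.
Proof.
apply: eq_bigr => i _; congr (_ * _).
by rewrite indicE mem_setE in_itv.
Qed.

Lemma measurable_step_fun (p : @step_data R) (D : set R) :
  measurable_fun D (step_fun p).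
Proof.
apply: measurable_funTS.
rewrite (_ : step_fun p = fun x => \sum_(i <- p) i.1 * \1_(`]i.2.1, i.2.2]%classic) x).
  2: by apply/funext => x; rewrite step_fun_indic.
apply: measurable_sum => i; apply: measurable_funM => //.
Qed.

Lemma sqint_step_fun (b : R) (p : @step_data R) : sqint mu `[0, b] (step_fun p).
Proof.
elim: p => [|[c [s t]] p IH].
  rewrite (_ : step_fun _ = fun=> 0); last by apply/funext => x; rewrite /step_fun big_nil.
  by split => //; under eq_integral do rewrite expr0n/=; rewrite integral0 ltry.
rewrite (_ : step_fun _ = (fun x => step_fun p x + c * \1_(`]s, t]%classic) x)); last first.
  by apply/funext => x; rewrite /step_fun big_cons addrC/= indicE mem_setE in_itv.
apply: sqintDZ => //; split => //.
apply: (@le_lt_trans _ _ (\int[mu]_(x in `[0%R, b]) (cst 1%:E x))%E).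
  apply: ge0_le_integral => //.
  - by apply/measurable_EFinP; exact: measurable_funX.
  - by move=> x _; rewrite lee_fin indicE; case: (_ \in _); rewrite ?expr1n ?expr0n.
rewrite integral_cst//= lebesgue_measure_itv/=.
by case: ifP => _; rewrite ?mule0 ?ltry// -EFinB -EFinM ltry.
Qed.

Section linearity.
Context d (W : measurableType d) (P : probability W R) (X : R -> W -> R) (T : R).
Hypothesis mX : forall t, measurable_fun setT (X t).

Definition step_scale (c : R) (p : step_data) : step_data :=
  [seq (c * i.1, i.2) | i <- p].

Lemma step_scale_fun c p x : step_fun (step_scale c p) x = c * step_fun p x.
Proof.
by rewrite /step_fun big_map mulr_sumr; apply: eq_bigr => i _; rewrite mulrA.
Qed.

Lemma step_scale_int c p w : step_int X (step_scale c p) w = c * step_int X p w.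
Proof.
by rewrite /step_int big_map mulr_sumr; apply: eq_bigr => i _; rewrite mulrA.
Qed.

Lemma is_integral0 : is_integral P X T (fun=> 0) (fun=> 0).
Proof.
split; first exact: measurable_cst.
exists (fun=> [::]); split => //.
- rewrite [X in X @ _](_ : _ = (fun=> 0%E)); first exact: cvg_cst.
  apply/funext => k; rewrite -[RHS](integral0 mu `[0%R, T]%classic).
  by apply: eq_integral => x _; rewrite /step_fun big_nil subrr expr0n.
- rewrite [X in X @ _](_ : _ = (fun=> 0%E)); first exact: cvg_cst.
  apply/funext => k; rewrite -[RHS](integral0 P setT).
  by apply: eq_integral => x _; rewrite /step_int big_nil subrr expr0n.
Qed.

(** Concatenating step data adds the step functions and their elementary
integrals. *)
Lemma is_integralDZ (f g : R -> R) (Y Z : W -> R) (c : R) :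
  measurable_fun `[0, T] f -> measurable_fun `[0, T] g ->
  is_integral P X T f Y -> is_integral P X T g Z ->
  is_integral P X T (fun x => f x + c * g x) (fun w => Y w + c * Z w).
Proof.
move=> mf mg [mY [p [pT pf pY]]] [mZ [q [qT qg qZ]]]; split.
  by apply: measurable_funD => //; exact: measurable_funM.
exists (fun k => p k ++ step_scale c (q k)); split.
- move=> k; rewrite /step_in all_cat; apply/andP; split; first exact: pT.
  rewrite all_map; exact: qT.
- rewrite [X in X @ _](_ : _ = fun k => (\int[mu]_(x in `[0%R, T])
      (((step_fun (p k) x - f x) + c * (step_fun (q k) x - g x)) ^+ 2)%:E)%E).
    apply: cvg_sqintDZ => // k; apply: measurable_funB => //; exact: measurable_step_fun.
  apply/funext => k; apply: eq_integral => x _.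
  rewrite {1}/step_fun big_cat/= -/(step_fun _ _) -/(step_fun _ _) step_scale_fun.
  by congr (_ ^+ 2)%:E; ring.
- rewrite [X in X @ _](_ : _ = fun k => (\int[P]_x
      (((step_int X (p k) x - Y x) + c * (step_int X (q k) x - Z x)) ^+ 2)%:E)%E).
    apply: cvg_sqintDZ => // k; apply: measurable_funB => //; exact: measurable_step_int.
  apply/funext => k; apply: eq_integral => x _.
  rewrite {1}/step_int big_cat/= -/(step_int _ _ _) -/(step_int _ _ _) step_scale_int.
  by congr (_ ^+ 2)%:E; ring.
Qed.

Lemma is_integral_trig_sum (r : seq nat) (c : nat -> R) (Z : nat -> W -> R) :
  (forall j, j \in r -> is_integral P X T (phi j) (Z j)) ->
  is_integral P X T (trig_sum r c) (fun w => \sum_(j <- r) c j * Z j w).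
Proof.
elim: r => [_|j r IH H].
  rewrite (_ : trig_sum _ _ = fun=> 0); last first.
    by apply/funext => x; rewrite /trig_sum big_nil.
  rewrite (_ : (fun w => _) = (fun=> 0)); first exact: is_integral0.
  by apply/funext => w; rewrite big_nil.
rewrite (_ : trig_sum _ _ = (fun x => trig_sum r c x + c j * phi j x)); last first.
  by apply/funext => x; rewrite /trig_sum big_cons addrC.
rewrite (_ : (fun w => _) = (fun w => \sum_(i <- r) c i * Z i w + c j * Z j w)); last first.
  by apply/funext => w; rewrite big_cons addrC.
apply: is_integralDZ.
- exact: measurable_funTS (measurable_trig_sum r c).
- exact: measurable_funTS (measurable_phi j).
- by apply: IH => i ir; apply: H; rewrite in_cons ir orbT.
- by apply: H; rewrite mem_head.
Qed.

End linearity.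

Section shift_by_signal.
Variables (n : nat) (Q : probability (skorokhod R n) R) (S : signal R).

(** An increment of the observation over [(a, b]] is the increment of the noise
plus the integral of [S] over [(a, b]]. *)
Lemma step_int_obs (p : step_data) (w : skorokhod R n) : step_in n%:R p ->
  step_int (coord_process n) p (obs S w) =
    \int[mu]_(x in `[0, n%:R]) (step_fun p x * S x)
    + step_int (coord_process n) p w.
Proof.
have iS (A : set R) : measurable A -> A `<=` `[0, n%:R]%classic -> mu.-integrable A (EFin \o S).
  by move=> mA An; apply: integrableS (signal_integrable n S).
have ind (a b : R) : 0 <= a -> b <= n%:R -> a <= b ->
    mu.-integrable `[0, n%:R] (EFin \o (S \_ `]a, b]%classic)) /\
    \int[mu]_(x in `[0, n%:R]) (S \_ `]a, b]%classic) x =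
      \int[mu]_(x in `[0, b]) S x - \int[mu]_(x in `[0, a]) S x.
  move=> a0 bn ab.
  have sub : `]a, b]%classic `<=` `[0, n%:R]%classic.
    move=> x /=; rewrite !in_itv/= => /andP[ax xb].
    by rewrite (le_trans a0 (ltW ax)) (le_trans xb bn).
  split.
    rewrite -restrict_EFin; apply/integrable_restrict => //.
    by rewrite setIidr//; exact: iS.
  rewrite -Rintegral_mkcondr setIidr// Rintegral_itvB ?bnd_simp//.
  by apply: iS => //; apply: subset_itvl; rewrite bnd_simp.
move=> pin.
have : mu.-integrable `[0, n%:R] (EFin \o (fun x => step_fun p x * S x)) /\
  step_int (coord_process n) p (obs S w) =
    \int[mu]_(x in `[0, n%:R]) (step_fun p x * S x) + step_int (coord_process n) p w;
  last by case.
elim: p pin => [_|[c [a b]] p IH /=].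
  split.
    rewrite (_ : _ \o _ = cst 0%E); first exact: integrable0.
    by apply/funext => x /=; rewrite /step_fun big_nil mul0r.
  rewrite /step_int !big_nil addr0; under eq_Rintegral do rewrite /step_fun big_nil mul0r.
  by rewrite Rintegral_cst// mul0r.
move=> /andP[/and3P[/= a0 ab bn] /IH[ip e]].
have [i1 e1] := ind _ _ a0 bn ab.
have i2 : mu.-integrable `[0, n%:R]
    (fun x => c%:E * (EFin \o (S \_ `]a, b]%classic)) x)%E by exact: integrableZl.
have E x : step_fun ((c, (a, b)) :: p) x * S x =
    c * (S \_ `]a, b]%classic) x + step_fun p x * S x.
  rewrite {1}/step_fun big_cons/= -/(step_fun p x) mulrDl; congr (_ + _).
  rewrite -mulrA; congr (_ * _); rewrite patchE mem_setE in_itv/=.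
  by case: ifP => _; rewrite ?mul1r ?mul0r.
split.
  rewrite (_ : _ \o _ = (fun x => c%:E * (EFin \o (S \_ `]a, b]%classic)) x
     + (EFin \o (fun x => step_fun p x * S x)%R) x)%E); first exact: integrableD.
  by apply/funext => x /=; rewrite E EFinD.
under eq_Rintegral do rewrite E.
rewrite RintegralD// RintegralZl// e1.
have stepS v : step_int (coord_process n) ((c, (a, b)) :: p) v =
    c * (coord_process n b v - coord_process n a v) + step_int (coord_process n) p v.
  by rewrite /step_int big_cons.
rewrite !stepS e /coord_process /= /obs_fun.
rewrite a0 (le_trans a0 ab) bn (le_trans ab bn)/=; ring.
Qed.

(** The step functions that approximate [f] for the observation approximate it
for the noise as well: the two elementary integrals differ by the integral of
the step function times [S], which converges to the integral of [f * S] by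
Cauchy-Schwarz. *)
Lemma is_integral_obs (f : R -> R) (Y : skorokhod R n -> R) :
  sqint mu `[0, n%:R] f ->
  is_integral (obs_law Q S) (coord_process n) n%:R f Y ->
  is_integral Q (coord_process n) n%:R f
    (fun w => Y (obs S w) - \int[mu]_(x in `[0, n%:R]) (f x * S x)).
Proof.
move=> sf [mY [p [pT pf pY]]].
have mYo : measurable_fun setT (fun w => Y (obs S w)).
  by apply: measurableT_comp mY _; exact: measurable_obs.
split; first exact: measurable_funB.
exists p; split => //.
have mp k : measurable_fun setT (step_int (coord_process n) (p k)).
  by apply: measurable_step_int; exact: measurable_coord.
have sS := sqint_signal n S.
have sp k : sqint mu `[0, n%:R] (step_fun (p k)).
  exact: sqint_step_fun.
pose b k := \int[mu]_(x in `[0, n%:R]) ((f x - step_fun (p k) x) * S x).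
have bE k : b k = \int[mu]_(x in `[0, n%:R]) (f x * S x)
   - \int[mu]_(x in `[0, n%:R]) (step_fun (p k) x * S x).
  rewrite -RintegralB//; [|exact: (sqint_integrableM _ sf sS)|exact: (sqint_integrableM _ (sp k) sS)].
  by apply: eq_Rintegral => x _; rewrite mulrBl.
rewrite [X in X @ _](_ : _ = fun k => (\int[Q]_w
      (((step_int (coord_process n) (p k) (obs S w) - Y (obs S w)) + 1 * b k) ^+ 2)%:E)%E); last first.
  apply/funext => k; apply: eq_integral => w _.
  by rewrite step_int_obs// bE; congr (_ ^+ 2)%:E; ring.
apply: (@cvg_sqintDZ _ _ _ Q setT measurableT _ (fun k => cst (b k)) 1) => //.
- move=> k; apply: measurable_funB => //.
  by apply: measurableT_comp (mp k) _; exact: measurable_obs.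
- rewrite [X in X @ _](_ : _ = fun k => (\int[obs_law Q S]_w
      ((step_int (coord_process n) (p k) w - Y w) ^+ 2)%:E)%E)//; apply/funext => k.
  rewrite ge0_integral_distribution//; last by move=> w; rewrite lee_fin sqr_ge0.
  by apply/measurable_EFinP; apply: measurable_funX; exact: measurable_funB.
- rewrite [X in X @ _](_ : _ = fun k => (b k ^+ 2)%:E); last first.
    apply/funext => k; transitivity (\int[Q]_w cst (b k ^+ 2)%:E w)%E => //.
    by rewrite integral_cst//= probability_setT mule1.
  pose C := \int[mu]_(x in `[0, n%:R]) (S x ^+ 2).
  have H : ((C%:E * \int[mu]_(x in `[0%R, n%:R]) ((step_fun (p k) x - f x) ^+ 2)%:E) @[k --> \oo] --> 0)%E.
    by rewrite -[X in _ --> X](mule0 C%:E); exact: cvgeZl.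
  apply: (@squeeze_cvge _ _ _ _ (fun=> 0%E) _ _ _ _ (cvg_cst _) H).
  near=> k; rewrite lee_fin sqr_ge0/=.
  have sfp : sqint mu `[0, n%:R] (fun x => f x - step_fun (p k) x).
    rewrite (_ : (fun x => _) = (fun x => f x + -1 * step_fun (p k) x)).
      exact: sqintDZ.
    by apply/funext => x; rewrite mulN1r.
  have CS : b k ^+ 2 <= \int[mu]_(x in `[0, n%:R]) ((f x - step_fun (p k) x) ^+ 2) * C.
    exact: cauchy_schwarz.
  have fin : (\int[mu]_(x in `[0%R, n%:R]) ((f x - step_fun (p k) x) ^+ 2)%:E)%E \is a fin_num.
    by apply: integrable_fin_num => //; exact: sqint_integrable_sqr.
  rewrite [X in (_ * X)%E](_ : _ =
      (\int[mu]_(x in `[0, n%:R]) ((f x - step_fun (p k) x) ^+ 2))%:E); last first.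
    rewrite fineK//; apply: eq_integral => x _; congr _%:E; ring.
  by rewrite -EFinM lee_fin mulrC.
Unshelve. all: by end_near. Qed.

End shift_by_signal.
End wiener_type_integrals.

(** * The oracle inequality for a fixed observation *)

Section oracle.
Context {R : realType} (r : seq nat).
Implicit Types (t h a g d c : nat -> R) (K s shat rho : R).

(** For [t] the Fourier coefficients of [S], [h] their estimates and
[K = |S|^2], this is the loss of the estimator with weights [g]. *)
Definition seq_loss K t h g : R :=
  \sum_(j <- r) (g j) ^+ 2 * (h j) ^+ 2 - 2 * \sum_(j <- r) g j * h j * t j + K.

(** The selection criterion, where [shat] stands for the estimated variance of
one coefficient, the estimate of [varsigma] divided by [n]. *)
Definition seq_cost shat rho h g : R :=
  \sum_(j <- r) (g j) ^+ 2 * (h j) ^+ 2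
  - 2 * \sum_(j <- r) g j * ((h j) ^+ 2 - shat)
  + rho * (shat * \sum_(j <- r) (g j) ^+ 2).

Definition quad_fluct t h a g : R :=
  \sum_(j <- r) g j * ((h j - t j) ^+ 2 - a j).

Definition energy t d : R := \sum_(j <- r) (d j * t j) ^+ 2.

Definition lin_fluct t h c : R := \sum_(j <- r) c j * (h j - t j).

Lemma young2 (e b : R) : 0 < e -> 2 * b <= e + b ^+ 2 / e.
Proof.
move=> e0; rewrite -subr_ge0.
have -> : e + b ^+ 2 / e - 2 * b = (e - b) ^+ 2 / e by field; rewrite gt_eqF.
by rewrite divr_ge0 ?sqr_ge0 ?ltW.
Qed.

(** The cost replaces the unknown [h * t] of the loss by [h^2 - shat], and
[h^2 - h t = t (h - t) + (h - t)^2]; the last square is split around its mean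
[a], and [a] around [s]. *)
Lemma seq_loss_cost K t h a s shat rho g :
  seq_loss K t h g = seq_cost shat rho h g
    + 2 * lin_fluct t h (fun j => g j * t j)
    + 2 * \sum_(j <- r) g j * (a j - s)
    + 2 * quad_fluct t h a g
    + 2 * (s - shat) * \sum_(j <- r) g j
    + K - rho * shat * \sum_(j <- r) (g j) ^+ 2.
Proof.
rewrite /seq_loss /seq_cost /quad_fluct /lin_fluct.
elim: r => [|j q IH]; first by rewrite !big_nil; ring.
rewrite !big_cons; move: IH; lra.
Qed.

Lemma seq_lossE K t h g :
  seq_loss K t h g =
    \sum_(j <- r) (g j * h j - t j) ^+ 2 + (K - \sum_(j <- r) (t j) ^+ 2).
Proof.
rewrite /seq_loss.
elim: r => [|j q IH]; first by rewrite !big_nil; ring.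
rewrite !big_cons; move: IH; lra.
Qed.

Lemma seq_loss_ge0 K t h g : \sum_(j <- r) (t j) ^+ 2 <= K ->
  0 <= seq_loss K t h g.
Proof.
by move=> tK; rewrite seq_lossE addr_ge0 ?subr_ge0// sumr_ge0// => j _; rewrite sqr_ge0.
Qed.

Lemma sum_sqr_eq0_mul d (e : nat -> R) : \sum_(j <- r) (d j) ^+ 2 = 0 ->
  \sum_(j <- r) d j * e j = 0.
Proof.
move=> /eqP; rewrite psumr_eq0 => [/allP H|j _]; last exact: sqr_ge0.
rewrite big_seq big1// => j /H; rewrite sqrf_eq0 => /eqP ->; exact: mul0r.
Qed.

(** The energy [D = sum d^2 t^2] is unknown, whereas [sum d^2 h^2] is the energy
of the difference of two estimators, at most twice the sum of their losses.
As [D <= sum d^2 h^2 - 2 sum d^2 t (h - t)], applying Young's inequality to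
the last sum bounds [(1 - rho) D].  The variances of both fluctuations are
at most of order [D], so the quotients by [D] have bounded means; when [D = 0]
the fluctuations vanish and so do the quotients. *)
Lemma lin_fluct_bound K t h d g g0 rho : 0 < rho < 1 / 3 ->
  \sum_(j <- r) (t j) ^+ 2 <= K ->
  (d = fun j => g j - g0 j) ->
  (1 - rho) * (2 * lin_fluct t h (fun j => d j * t j)) <=
    2 * rho * (seq_loss K t h g + seq_loss K t h g0)
    + (1 - rho) * (lin_fluct t h (fun j => d j * t j) ^+ 2 / (rho * energy t d))
    + lin_fluct t h (fun j => (d j) ^+ 2 * t j) ^+ 2 / energy t d.
Proof.
move=> /andP[rho0 rho3] tK dE.
set D := energy t d; set M := lin_fluct _ _ _; set M1 := lin_fluct _ _ (fun j => d j ^+ 2 * t j).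
have D0 : 0 <= D by apply: sumr_ge0 => j _; exact: sqr_ge0.
have E0 : 0 <= seq_loss K t h g by exact: seq_loss_ge0.
have E1 : 0 <= seq_loss K t h g0 by exact: seq_loss_ge0.
have [Dz|Dnz] := eqVneq D 0.
  have -> : M = 0 by exact: sum_sqr_eq0_mul.
  rewrite Dz !(mulr0, invr0, expr0n)/= !(mulr0, addr0).
  by apply: mulr_ge0; [lra|exact: addr_ge0].
have Dp : 0 < D by rewrite lt_neqAle eq_sym Dnz.
pose Dh := \sum_(j <- r) (d j * h j) ^+ 2.
have Dh_le : Dh <= 2 * (seq_loss K t h g + seq_loss K t h g0).
  have : Dh <= 2 * \sum_(j <- r) (g j * h j - t j) ^+ 2
              + 2 * \sum_(j <- r) (g0 j * h j - t j) ^+ 2.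
    rewrite !mulr_sumr -big_split/=; apply: ler_sum => j _; rewrite dE.
    have -> : (g j - g0 j) * h j = (g j * h j - t j) - (g0 j * h j - t j) by ring.
    have := sqr_ge0 ((g j * h j - t j) + (g0 j * h j - t j)); lra.
  rewrite !seq_lossE; lra.
have D_le : D <= Dh - 2 * M1.
  rewrite /M1 /lin_fluct mulr_sumr -sumrB; apply: ler_sum => j _.
  have : 0 <= (d j * (h j - t j)) ^+ 2 by exact: sqr_ge0.
  by rewrite -subr_ge0 [X in _ -> 0 <= X](_ : _ = (d j * (h j - t j)) ^+ 2)//; ring.
have Y1 := young2 M (mulr_gt0 rho0 Dp).
have Y2 := young2 (- M1) (mulr_gt0 rho0 Dp).
rewrite sqrrN in Y2.
have YE : M1 ^+ 2 / (rho * D) * rho = M1 ^+ 2 / D.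
  by field; rewrite (gt_eqF rho0) Dnz.
rewrite -YE.
have Y3 : (1 - rho) * (2 * M) <= (1 - rho) * (rho * D + M ^+ 2 / (rho * D)).
  by rewrite ler_wpM2l//; lra.
have : rho * ((1 - rho) * D) <= rho * (Dh + M1 ^+ 2 / (rho * D)).
  by rewrite ler_wpM2l ?(ltW rho0)//; lra.
have : rho * Dh <= rho * (2 * (seq_loss K t h g + seq_loss K t h g0)).
  by rewrite ler_wpM2l ?(ltW rho0).
move: Y3; lra.
Qed.

(** The two Young inequalities for the quadratic fluctuations contribute
[rho * s * |g|^2] and [rho * s * |g0|^2].  The penalty of [g] cancels the
former up to the variance error, and the penalty of [g0] doubles the latter. *)
Lemma seq_oracle K t h a g g0 d s shat rho mu lam :
  0 < rho < 1 / 3 -> 0 < s ->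
  \sum_(j <- r) (t j) ^+ 2 <= K ->
  (forall j, j \in r -> 0 <= g j <= 1) ->
  (forall j, j \in r -> 0 <= g0 j <= 1) ->
  \sum_(j <- r) g j <= mu -> \sum_(j <- r) g0 j <= mu ->
  0 < \sum_(j <- r) (g j) ^+ 2 -> 0 < \sum_(j <- r) (g0 j) ^+ 2 ->
  `|\sum_(j <- r) g j * (a j - s)| <= lam ->
  `|\sum_(j <- r) g0 j * (a j - s)| <= lam ->
  seq_cost shat rho h g <= seq_cost shat rho h g0 ->
  d = (fun j => g j - g0 j) ->
  (1 - 3 * rho) * seq_loss K t h g <=
    (1 + rho) * seq_loss K t h g0
    + (1 - rho) * (2 * rho * (s * \sum_(j <- r) (g0 j) ^+ 2) + 4 * lam
         + (2 + 2 * rho) * mu * `|shat - s|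
         + quad_fluct t h a g ^+ 2 / (rho * (s * \sum_(j <- r) (g j) ^+ 2))
         + quad_fluct t h a g0 ^+ 2 / (rho * (s * \sum_(j <- r) (g0 j) ^+ 2))
         + lin_fluct t h (fun j => d j * t j) ^+ 2 / (rho * energy t d))
    + lin_fluct t h (fun j => (d j) ^+ 2 * t j) ^+ 2 / energy t d.
Proof.
move=> rhob s0 tK g01 g001 gmu g0mu gp g0p ga g0a cost dE.
have /andP[rho0 rho3] := rhob.
have := @lin_fluct_bound K t h d g g0 rho rhob tK dE.
set D := energy t d.
have -> : lin_fluct t h (fun j => d j * t j) =
    lin_fluct t h (fun j => g j * t j) - lin_fluct t h (fun j => g0 j * t j).
  by rewrite /lin_fluct -sumrB; apply: eq_bigr => j _; rewrite dE; ring.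
set M := lin_fluct t h (fun j => g j * t j).
set M0 := lin_fluct t h (fun j => g0 j * t j).
have := @seq_loss_cost K t h a s shat rho g.
have := @seq_loss_cost K t h a s shat rho g0.
rewrite -/M -/M0.
have Y := @young2 _ (quad_fluct t h a g) (mulr_gt0 rho0 (mulr_gt0 s0 gp)).
have Y0 := @young2 _ (- quad_fluct t h a g0) (mulr_gt0 rho0 (mulr_gt0 s0 g0p)).
rewrite sqrrN in Y0.
have sumsq (f : nat -> R) : (forall j, j \in r -> 0 <= f j <= 1) ->
    0 <= \sum_(j <- r) (f j) ^+ 2 <= \sum_(j <- r) f j.
  move=> f01; rewrite sumr_ge0 => [/=|j _]; last exact: sqr_ge0.
  by rewrite !big_seq; apply: ler_sum => j /f01/andP[]; nra.
have /andP[_ gs] := sumsq _ g01.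
have /andP[_ g0s] := sumsq _ g001.
move: ga g0a Y Y0 gs g0s gp g0p gmu g0mu cost.
rewrite !ler_norml.
move: (lin_fluct t h (fun j => d j ^+ 2 * t j) ^+ 2 / D) ((M - M0) ^+ 2 / (rho * D)) => U V.
move: (seq_loss K t h g) (seq_loss K t h g0) (seq_cost _ _ _ g) (seq_cost _ _ _ g0) => E E0 C C0.
move: (quad_fluct t h a g ^+ 2 / _) (quad_fluct t h a g0 ^+ 2 / _) => W W0.
move: (quad_fluct t h a g) (quad_fluct t h a g0) => B B0.
move: (\sum_(j <- r) g j * _) (\sum_(j <- r) g0 j * _) => A A0.
move: (\sum_(j <- r) g j ^+ 2) (\sum_(j <- r) g0 j ^+ 2).
move: (\sum_(j <- r) g j) (\sum_(j <- r) g0 j) M M0 => l l0 M M0 q q0.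
move=> /andP[A1 A2] /andP[A01 A02] Y Y0 gs g0s gp g0p gmu g0mu cost eE0 eE bM.
set e := `|shat - s|.
have [e1 e2] : - e <= shat - s /\ shat - s <= e.
  by apply/andP; rewrite -ler_norml.
have e0 : 0 <= e by exact: normr_ge0.
have H1 : (s - shat) * (l - l0) <= mu * e.
  have [le0|le0] := leP l l0.
    have : 0 <= (e + (s - shat)) * (l0 - l) by rewrite mulr_ge0; lra.
    have : 0 <= e * (mu - l0 + l) by rewrite mulr_ge0//; lra.
    lra.
  have : 0 <= (e - (s - shat)) * (l - l0) by rewrite mulr_ge0; lra.
  have : 0 <= e * (mu - l + l0) by rewrite mulr_ge0//; lra.
  lra.
have H2 : (s - shat) * q <= mu * e.
  have : 0 <= (e - (s - shat)) * q by rewrite mulr_ge0; lra.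
  have : 0 <= e * (mu - q) by rewrite mulr_ge0//; lra.
  lra.
have H3 : (shat - s) * q0 <= mu * e.
  have : 0 <= (e - (shat - s)) * q0 by rewrite mulr_ge0; lra.
  have : 0 <= e * (mu - q0) by rewrite mulr_ge0//; lra.
  lra.
have H4 : rho * ((s - shat) * q + (shat - s) * q0) <= rho * (2 * (mu * e)).
  by rewrite ler_wpM2l ?(ltW rho0)//; lra.
have H5 : E <= E0 + 2 * (M - M0) + (2 * rho * (s * q0) + 4 * lam
   + (2 + 2 * rho) * mu * e + W + W0).
  by rewrite eE eE0; lra.
have : (1 - rho) * E <= (1 - rho) * (E0 + 2 * (M - M0) + (2 * rho * (s * q0) + 4 * lam
   + (2 + 2 * rho) * mu * e + W + W0)).
  by rewrite ler_wpM2l//; lra.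
move: bM; lra.
Qed.

End oracle.

(** * The oracle inequality in mean *)

Section mean_bounds.
Context d (T : measurableType d) (R : realType) (P : probability T R).
Implicit Types (f g : T -> R) (u v : \bar R).

(** Measurability and sign travel with the bound, since integrating a sum of
nonnegative functions term by term requires both. *)
Definition mean_le f u :=
  [/\ measurable_fun setT f, (forall y, 0 <= f y) & (\int[P]_y (f y)%:E <= u)%E].

Lemma mean_leD f g u v : mean_le f u -> mean_le g v ->
  mean_le (fun y => f y + g y) (u + v)%E.
Proof.
move=> [mf f0 fu] [mg g0 gv]; split; first exact: measurable_funD.
  by move=> y; rewrite addr_ge0.
under eq_integral do rewrite EFinD.
rewrite ge0_integralD//; first exact: leeD.
- by move=> y _; rewrite lee_fin.
- exact/measurable_EFinP.
- by move=> y _; rewrite lee_fin.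
- exact/measurable_EFinP.
Qed.

Lemma mean_leZ (c : R) f u : 0 <= c -> mean_le f u ->
  mean_le (fun y => c * f y) (c%:E * u)%E.
Proof.
move=> c0 [mf f0 fu]; split; first exact: measurable_funM.
  by move=> y; rewrite mulr_ge0.
under eq_integral do rewrite EFinM.
rewrite ge0_integralZl_EFin//.
- by rewrite lee_wpmul2l.
- by move=> y _; rewrite lee_fin.
- exact/measurable_EFinP.
Qed.

Lemma mean_le_cst (c : R) : 0 <= c -> mean_le (fun=> c) c%:E.
Proof.
move=> c0; split => //.
by rewrite (integral_cst P measurableT c%:E)/= probability_setT mule1.
Qed.

Lemma mean_le_sum (I : eqType) (r : seq I) (f : I -> T -> R) (u : R) :
  (forall i, i \in r -> mean_le (f i) u%:E) ->
  mean_le (fun y => \sum_(i <- r) f i y) ((size r)%:R * u)%:E.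
Proof.
elim: r => [_|i r IH H].
  rewrite mul0r (_ : (fun y => _) = (fun=> 0)); first exact: mean_le_cst.
  by apply/funext => y; rewrite big_nil.
rewrite (_ : (fun y => _) = (fun y => f i y + \sum_(j <- r) f j y)); last first.
  by apply/funext => y; rewrite big_cons.
rewrite /= -nat1r mulrDl mul1r EFinD; apply: mean_leD.
  by apply: H; rewrite mem_head.
by apply: IH => j jr; apply: H; rewrite in_cons jr orbT.
Qed.

Lemma mean_le_trans f u v : (u <= v)%E -> mean_le f u -> mean_le f v.
Proof. by move=> uv [mf f0 fu]; split => //; exact: le_trans uv. Qed.

End mean_bounds.

Section oracle_in_mean.
Context d (T : measurableType d) (R : realType) (P : probability T R).
Variables (r : seq nat) (t a : nat -> R) (h : nat -> T -> R) (K : R).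
Hypothesis tK : \sum_(j <- r) (t j) ^+ 2 <= K.
Hypothesis mh : forall j, j \in r -> measurable_fun setT (h j).
Hypothesis mean0 : forall j, j \in r ->
  P.-integrable setT (fun y => (h j y - t j)%:E) /\
  (\int[P]_y (h j y - t j)%:E = 0)%E.
Hypothesis var : forall j, j \in r ->
  (\int[P]_y ((h j y - t j) ^+ 2)%:E = (a j)%:E)%E.

Local Notation loss g y := (seq_loss r K t (h ^~ y) g).

Lemma measurable_sum_in (f : nat -> T -> R) :
  (forall j, j \in r -> measurable_fun setT (f j)) ->
  measurable_fun setT (fun y => \sum_(j <- r) f j y).
Proof.
move=> mf.
rewrite (_ : (fun y => _) = (fun y => \sum_(j <- r) (if j \in r then f j else cst 0) y)).
  by apply: measurable_sum => j; case: ifP => [/mf//|_]; exact: measurable_cst.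
by apply/funext => y; rewrite !big_seq; apply: eq_bigr => j ->.
Qed.

Lemma measurable_lin_fluct (c : nat -> R) :
  measurable_fun setT (fun y => lin_fluct r t (h ^~ y) c).
Proof.
apply: measurable_sum_in => j jr; apply: measurable_funM => //.
by apply: measurable_funB => //; exact: mh.
Qed.

Lemma measurable_quad_fluct (g : nat -> R) :
  measurable_fun setT (fun y => quad_fluct r t (h ^~ y) a g).
Proof.
apply: measurable_sum_in => j jr; apply: measurable_funM => //.
apply: measurable_funB => //; apply: measurable_funX.
by apply: measurable_funB => //; exact: mh.
Qed.

Lemma measurable_loss (g : nat -> R) : measurable_fun setT (fun y => loss g y).
Proof.
apply: measurable_funD => //; apply: measurable_funB.
  apply: measurable_sum_in => j jr; apply: measurable_funM => //.
  by apply: measurable_funX; exact: mh.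
apply: measurable_funM => //; apply: measurable_sum_in => j jr.
by apply: measurable_funM => //; apply: measurable_funM => //; exact: mh.
Qed.

(** Bias-variance decomposition of one coefficient: writing [x = h j - t j],
[g h - t = (g - 1) t + g x] and [x] is centred. *)
Lemma integral_component_loss (j : nat) (g : R) : j \in r ->
  (\int[P]_y ((g * h j y - t j) ^+ 2)%:E =
     ((g - 1) ^+ 2 * (t j) ^+ 2 + g ^+ 2 * a j)%:E)%E.
Proof.
move=> jr; have [i1 e1] := mean0 jr; have e2 := var jr.
have i2 : P.-integrable setT (fun y => ((h j y - t j) ^+ 2)%:E).
  apply/integrableP; split.
    apply/measurable_EFinP; apply: measurable_funX; apply: measurable_funB => //.
    exact: mh.
  under eq_integral do rewrite gee0_abs ?lee_fin ?sqr_ge0//.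
  by rewrite e2 ltry.
have i0 : P.-integrable setT (cst ((g - 1) ^+ 2 * (t j) ^+ 2)%:E).
  exact: finite_measure_integrable_cst.
transitivity (\int[P]_y (((g - 1) ^+ 2 * (t j) ^+ 2)%:E
  + ((2 * g * (g - 1) * t j)%:E * (h j y - t j)%:E
  + (g ^+ 2)%:E * ((h j y - t j) ^+ 2)%:E)))%E.
  by apply: eq_integral => y _; rewrite -!EFinM -!EFinD; congr _%:E; ring.
rewrite integralD//; last by apply: integrableD => //; exact: integrableZl.
rewrite integralD//; [|exact: integrableZl..].
rewrite !integralZl// e1 e2 mule0 add0e.
rewrite (integral_cst P measurableT)/= probability_setT mule1.
by rewrite -EFinM -EFinD.
Qed.

(** The mean loss is at least its variance part [sum g^2 a], and [a] is close to
[s] in the weak sense measured by [lam]. *)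
Lemma loss_lower_bound (g : nat -> R) (s lam : R) :
  `|\sum_(j <- r) (g j) ^+ 2 * (a j - s)| <= lam ->
  ((s * \sum_(j <- r) (g j) ^+ 2)%:E <= \int[P]_y (loss g y)%:E + lam%:E)%E.
Proof.
move=> glam; rewrite -leeBlDr// -EFinB.
apply: (@le_trans _ _ (\int[P]_y (\sum_(j <- r) ((if j \in r then g j * h j y - t j else 0) ^+ 2)%:E))%E).
  rewrite ge0_integral_sum//; last 2 first.
  - move=> j; apply/measurable_EFinP; apply: measurable_funX.
    have [jr|_] := boolP (j \in r); last exact: measurable_cst.
    apply: measurable_funB => //; apply: measurable_funM => //.
    exact: mh.
  - by move=> j y _; rewrite lee_fin sqr_ge0.
  rewrite (@eq_big_seq _ _ _ _ _ _ (fun j => ((g j - 1) ^+ 2 * (t j) ^+ 2 + g j ^+ 2 * a j)%:E)); last first.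
    move=> j jr; rewrite -integral_component_loss//.
    by apply: eq_integral => y _; rewrite jr.
  rewrite sumEFin lee_fin.
  apply: (@le_trans _ _ (\sum_(j <- r) g j ^+ 2 * a j)).
    move: glam; rewrite ler_norml => /andP[glam _].
    rewrite (_ : \sum_(j <- r) g j ^+ 2 * a j =
        \sum_(j <- r) g j ^+ 2 * (a j - s) + s * \sum_(j <- r) g j ^+ 2); first lra.
    by rewrite mulr_sumr -big_split/=; apply: eq_bigr => j _; ring.
  by apply: ler_sum => j _; rewrite lerDr mulr_ge0// sqr_ge0.
apply: ge0_le_integral => //.
- by move=> y _; apply: sume_ge0 => j _; rewrite lee_fin sqr_ge0.
- apply: emeasurable_sum => j; apply/measurable_EFinP; apply: measurable_funX.
  have [jr|_] := boolP (j \in r); last exact: measurable_cst.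
  apply: measurable_funB => //; apply: measurable_funM => //.
  exact: mh.
- by apply/measurable_EFinP; exact: measurable_loss.
- move=> y _; rewrite sumEFin lee_fin seq_lossE.
  rewrite [leLHS]big_seq [X in _ <= X + _]big_seq.
  rewrite (@eq_bigr _ _ _ _ _ _ _ (fun j => (g j * h j y - t j) ^+ 2)); last by move=> j ->.
  by rewrite lerDl subr_ge0.
Qed.

Variables (Gamma : {fset nat -> R}) (s rho mu lam kappa tau : R).
Variables (shat : T -> R) (ghat : T -> nat -> R).
Hypothesis rho_bd : 0 < rho < 1 / 3.
Hypotheses (s0 : 0 < s) (tau0 : 0 <= tau).
Hypothesis Gamma01 : forall g, g \in Gamma -> forall j, j \in r -> 0 <= g j <= 1.
Hypothesis Gamma_mu : forall g, g \in Gamma -> \sum_(j <- r) g j <= mu.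
Hypothesis Gamma_gt0 : forall g, g \in Gamma -> 0 < \sum_(j <- r) (g j) ^+ 2.
Hypothesis Gamma_bias : forall g, g \in Gamma ->
  `|\sum_(j <- r) g j * (a j - s)| <= lam.
Hypothesis Gamma_bias_sqr : forall g, g \in Gamma ->
  `|\sum_(j <- r) (g j) ^+ 2 * (a j - s)| <= lam.
Hypothesis lin_mean : forall c : nat -> R,
  (\int[P]_y ((lin_fluct r t (h ^~ y) c) ^+ 2)%:E <=
     (tau * \sum_(j <- r) (c j) ^+ 2)%:E)%E.
Hypothesis quad_mean : forall g, g \in Gamma ->
  (\int[P]_y ((quad_fluct r t (h ^~ y) a g) ^+ 2)%:E <=
     (kappa * \sum_(j <- r) (g j) ^+ 2)%:E)%E.
Hypothesis mshat : measurable_fun setT shat.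
Hypothesis ghat_in : forall y, ghat y \in Gamma.
Hypothesis ghat_min : forall y g, g \in Gamma ->
  seq_cost r (shat y) rho (h ^~ y) (ghat y) <= seq_cost r (shat y) rho (h ^~ y) g.
Hypothesis mghat : forall g, g \in Gamma -> measurable [set y | ghat y = g].

Lemma measurable_selected_loss : measurable_fun setT (fun y => loss (ghat y) y).
Proof.
rewrite (_ : (fun y => _) =
    (fun y => \sum_(g <- Gamma) \1_[set y | ghat y = g] y * loss g y)).
  rewrite (_ : (fun y => _) = (fun y => \sum_(g <- Gamma)
      (if g \in Gamma then (fun y => \1_[set y | ghat y = g] y * loss g y) else cst 0) y)).
    apply: measurable_sum => g; case: ifP => [gG|_]; last exact: measurable_cst.
    apply: measurable_funM; last exact: measurable_loss.
    by apply: measurable_indic; exact: mghat.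
  by apply/funext => y; rewrite !big_seq; apply: eq_bigr => g ->.
apply/funext => y.
rewrite (bigD1_seq (ghat y) (ghat_in y) (fset_uniq Gamma))/= big1 ?addr0; last first.
  move=> g gn; rewrite indicE memNset ?mul0r//= => e.
  by rewrite e eqxx in gn.
by rewrite indicE mem_set ?mul1r.
Qed.

Lemma mean_le_lin (c : nat -> R) (D : R) : 0 <= D ->
  \sum_(j <- r) (c j) ^+ 2 <= D ->
  mean_le P (fun y => lin_fluct r t (h ^~ y) c ^+ 2 / D) tau%:E.
Proof.
move=> D0 cD.
rewrite (_ : (fun y => _) = (fun y => D^-1 * lin_fluct r t (h ^~ y) c ^+ 2)); last first.
  by apply/funext => y; rewrite mulrC.
apply: (@mean_le_trans _ _ _ _ _ (D^-1%:E * (tau * \sum_(j <- r) (c j) ^+ 2)%:E)%E).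
  rewrite -EFinM lee_fin.
  have [->|Dn] := eqVneq D 0; first by rewrite invr0 mul0r.
  rewrite mulrC ler_pdivrMr ?lt_neqAle ?(eq_sym 0) ?Dn//.
  by rewrite ler_wpM2l.
apply: mean_leZ; first by rewrite invr_ge0.
split; last exact: lin_mean.
- by apply: measurable_funX; exact: measurable_lin_fluct.
- by move=> y; exact: sqr_ge0.
Qed.

Lemma mean_le_quad (g : nat -> R) : g \in Gamma ->
  mean_le P (fun y => quad_fluct r t (h ^~ y) a g ^+ 2
     / (rho * (s * \sum_(j <- r) (g j) ^+ 2))) (kappa / (rho * s))%:E.
Proof.
move=> gG; have /andP[rho0 _] := rho_bd; have g0 := Gamma_gt0 gG.
set q := \sum_(j <- r) _ in g0 *.
rewrite (_ : (fun y => _) = (fun y => (rho * (s * q))^-1 *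
    quad_fluct r t (h ^~ y) a g ^+ 2)); last first.
  by apply/funext => y; rewrite mulrC.
have -> : (kappa / (rho * s))%:E = ((rho * (s * q))^-1%:E * (kappa * q)%:E)%E.
  by rewrite -EFinM; congr _%:E; field; rewrite !gt_eqF.
apply: mean_leZ; first by rewrite invr_ge0 !mulr_ge0// ltW.
split; last exact: quad_mean.
- by apply: measurable_funX; exact: measurable_quad_fluct.
- by move=> y; exact: sqr_ge0.
Qed.

(** The selected weights are random, but the squared fluctuations are
nonnegative: each is at most the sum over [Gamma] of its analogues for fixed
weights, whose means are bounded one by one. *)
Lemma mean_oracle (g0 : nat -> R) : g0 \in Gamma ->
  (\int[P]_y (loss (ghat y) y)%:E <=
    ((1 + 3 * rho - 2 * rho ^+ 2) / (1 - 3 * rho))%:E * \int[P]_y (loss g0 y)%:E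
    + (((1 - rho) * (4 + 2 * rho) * lam
        + #|` Gamma|%:R * (2 * kappa / (rho * s) + tau / rho)) / (1 - 3 * rho))%:E
    + (6 / (1 - 3 * rho) * mu)%:E * \int[P]_y `|shat y - s|%:E)%E.
Proof.
move=> g0G; have /andP[rho0 rho3] := rho_bd.
have q0 : 0 < 1 - 3 * rho by lra.
pose q := (1 - 3 * rho)^-1; have qp : 0 < q by rewrite invr_gt0.
have lam0 : 0 <= lam by apply: le_trans (Gamma_bias g0G); exact: normr_ge0.
have mu0 : 0 <= mu.
  apply: le_trans (Gamma_mu g0G); rewrite big_seq; apply: sumr_ge0 => j jr.
  by case/andP: (Gamma01 g0G jr).
pose dg g (j : nat) := g j - g0 j.
pose V g y := quad_fluct r t (h ^~ y) a g ^+ 2 / (rho * (s * \sum_(j <- r) (g j) ^+ 2)).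
pose M g y := lin_fluct r t (h ^~ y) (fun j => dg g j * t j) ^+ 2 / energy r t (dg g).
pose N g y := lin_fluct r t (h ^~ y) (fun j => (dg g j) ^+ 2 * t j) ^+ 2 / energy r t (dg g).
have energy0 g : 0 <= energy r t (dg g) by apply: sumr_ge0 => j _; exact: sqr_ge0.
have mV g : g \in Gamma -> mean_le P (V g) (kappa / (rho * s))%:E by exact: mean_le_quad.
have mM g : g \in Gamma -> mean_le P (M g) tau%:E by move=> gG; exact: mean_le_lin.
have mN g : g \in Gamma -> mean_le P (N g) tau%:E.
  move=> gG; apply: mean_le_lin => //.
  rewrite big_seq [leRHS]big_seq; apply: ler_sum => j jr.
  rewrite !exprMn ler_wpM2r ?sqr_ge0// -[leRHS]mulr1 expr2 ler_wpM2l ?sqr_ge0//.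
  have /andP[? ?] := Gamma01 gG jr; have /andP[? ?] := Gamma01 g0G jr.
  rewrite /dg; nra.
have loss0 g y : 0 <= loss g y by exact: seq_loss_ge0.
set E0 := (\int[P]_y (loss g0 y)%:E)%E; set e := (\int[P]_y `|shat y - s|%:E)%E.
have mloss : mean_le P (fun y => loss g0 y) E0.
  by split => //; exact: measurable_loss.
have me : mean_le P (fun y => `|shat y - s|) e.
  split => //; apply: measurableT_comp => //; exact: measurable_funB.
pose c0 := q * ((1 - rho) * (2 * rho * (s * \sum_(j <- r) (g0 j) ^+ 2) + 4 * lam)).
have c0p : 0 <= c0.
  rewrite !mulr_ge0 ?(ltW qp)//; first lra.
  by rewrite addr_ge0// ?mulr_ge0 ?(ltW rho0) ?(ltW s0) ?(ltW (Gamma_gt0 g0G)).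
have sumM := @mean_le_sum _ _ _ P _ Gamma _ _ mM.
have sumN := @mean_le_sum _ _ _ P _ Gamma _ _ mN.
have sumV := @mean_le_sum _ _ _ P _ Gamma _ _ mV.
have cA : 0 <= q * (1 + rho) by rewrite mulr_ge0 ?(ltW qp)//; lra.
have cB : 0 <= q * ((1 - rho) * (2 + 2 * rho) * mu).
  by rewrite !mulr_ge0 ?(ltW qp)//; lra.
have cV : 0 <= q * ((1 - rho) * 2) by rewrite mulr_ge0 ?(ltW qp)//; lra.
have cM : 0 <= q * ((1 - rho) / rho).
  by rewrite mulr_ge0 ?(ltW qp)// divr_ge0//; lra.
have [mF F0 intF] := mean_leD (mean_leZ cA mloss) (mean_leD (mean_le_cst P c0p)
  (mean_leD (mean_leZ cB me) (mean_leD (mean_leZ cV sumV)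
  (mean_leD (mean_leZ cM sumM) (mean_leZ (ltW qp) sumN))))).
move: mF F0 intF; set F := (fun y => _) => mF F0 intF.
have pw y : loss (ghat y) y <= F y.
  have gG := ghat_in y.
  have := @seq_oracle R r K t (h ^~ y) a (ghat y) g0 (dg (ghat y)) s (shat y) rho mu lam
    rho_bd s0 tK (Gamma01 gG) (Gamma01 g0G) (Gamma_mu gG) (Gamma_mu g0G) (Gamma_gt0 gG)
    (Gamma_gt0 g0G) (Gamma_bias gG) (Gamma_bias g0G) (ghat_min y g0G) erefl.
  have big (f : (nat -> R) -> T -> R) g u : g \in Gamma ->
      (forall g, g \in Gamma -> mean_le P (f g) u) -> f g y <= \sum_(g <- Gamma) f g y.
    move=> gin fp; rewrite (bigD1_seq g gin (fset_uniq Gamma))/= lerDl.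
    rewrite big_seq_cond; apply: sumr_ge0 => g' /andP[g'in _].
    by case: (fp _ g'in).
  have b1 := big V (ghat y) _ gG mV; have b2 := big V g0 _ g0G mV.
  have b3 := big M (ghat y) _ gG mM; have b4 := big N (ghat y) _ gG mN.
  rewrite -/(V (ghat y) y) -/(V g0 y) -/(N (ghat y) y).
  have eM : lin_fluct r t (h ^~ y) (fun j => dg (ghat y) j * t j) ^+ 2
      / (rho * energy r t (dg (ghat y))) = rho^-1 * M (ghat y) y.
    by rewrite /M invfM mulrCA.
  rewrite eM.
  rewrite -ler_pdivlMl// -/q => /le_trans; apply.
  have b12 : (1 - rho) * (V (ghat y) y + V g0 y) <= (1 - rho) * (2 * \sum_(g <- Gamma) V g y).
    by rewrite ler_wpM2l//; lra.
  have b3' : (1 - rho) * (rho^-1 * M (ghat y) y)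
      <= (1 - rho) * (rho^-1 * \sum_(g <- Gamma) M g y).
    by rewrite ler_wpM2l//; [lra|rewrite ler_wpM2l// invr_ge0 ltW].
  rewrite /F /c0 -subr_ge0.
  have : 0 <= q * ((1 - rho) * (2 * \sum_(g <- Gamma) V g y) - (1 - rho) * (V (ghat y) y + V g0 y)
    + ((1 - rho) * (rho^-1 * \sum_(g <- Gamma) M g y) - (1 - rho) * (rho^-1 * M (ghat y) y))
    + (\sum_(g <- Gamma) N g y - N (ghat y) y)).
    by apply: mulr_ge0; [exact: ltW|lra].
  congr (_ <= _).
  move: (\sum_(g <- Gamma) V g y) (\sum_(g <- Gamma) M g y) (\sum_(g <- Gamma) N g y).
  by move=> *; ring.
have -> : 6 / (1 - 3 * rho) * mu = q * 6 * mu by rewrite /q [6 / _]mulrC.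
apply: (@le_trans _ _ (\int[P]_y (F y)%:E)%E).
  apply: ge0_le_integral => //.
  - by move=> y _; rewrite lee_fin.
  - by apply/measurable_EFinP; exact: measurable_selected_loss.
  - exact/measurable_EFinP.
  - by move=> y _; rewrite lee_fin.
apply: (le_trans intF).
have e0 : (0 <= e)%E by apply: integral_ge0 => y _; rewrite lee_fin.
have eB : ((q * ((1 - rho) * (2 + 2 * rho) * mu))%:E * e <= (q * 6 * mu)%:E * e)%E.
  rewrite lee_wpmul2r// lee_fin -[leRHS]mulrA ler_wpM2l ?(ltW qp)// ler_wpM2r//; nra.
have low := loss_lower_bound (Gamma_bias_sqr g0G).
have E00 : (0 <= E0)%E by apply: integral_ge0 => y _; rewrite lee_fin.
rewrite -/E0 in low *.
set G := #|` Gamma|%:R.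
rewrite addeCA addeA [X in (_ + X <= _)%E]addeC addeA.
apply: leeD eB.
clear mloss intF; clearbody E0; case: E0 E00 low => [x| |]//.
  rewrite -!EFinM -!EFinD !lee_fin => x0 low.
  have low' : q * ((1 - rho) * (2 * rho * (s * \sum_(j <- r) g0 j ^+ 2))) <=
      q * ((1 - rho) * (2 * rho * (x + lam))).
    rewrite ler_wpM2l ?(ltW qp)// ler_wpM2l//; first lra.
    by rewrite ler_wpM2l// mulr_ge0// ltW.
  have -> : q * ((1 - rho) / rho) * (G * tau) + q * (G * tau) = q * (G * (tau / rho)).
    by field; rewrite gt_eqF.
  have -> : q * ((1 - rho) * 2) * (G * (kappa / (rho * s)))
      = q * ((1 - rho) * (G * (2 * kappa / (rho * s)))) by ring.
  have kap : 0 <= kappa / (rho * s).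
    by rewrite -lee_fin; case: (mV _ g0G) => _ V0; apply: le_trans; apply: integral_ge0 => y _; rewrite lee_fin.
  have : q * ((1 - rho) * (G * (2 * kappa / (rho * s)))) <= q * (G * (2 * kappa / (rho * s))).
    rewrite ler_wpM2l ?(ltW qp)// ler_piMl//; last lra.
    by rewrite mulr_ge0// ?ler0n// -mulrA mulr_ge0.
  rewrite -/q /c0; lra.
move=> _ _; rewrite [X in (_ <= X + _)%E]gt0_muley ?addye ?leey//.
rewrite lte_fin divr_gt0//; nra.
Qed.
End oracle_in_mean.

(** * Sequences of finite support *)

Section finite_support.
Context {R : realType}.

Lemma series_finite_support (f : nat -> R) (N : nat) :
  (0 < N)%N -> (forall j, (N <= j)%N -> f j = 0) ->
  limn (fun k => \sum_(1 <= j < k) f j) = \sum_(1 <= j < N) f j.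
Proof.
move=> N0 fN; apply: lim_near_cst => //; exists N => // k /= Nk.
rewrite (big_cat_nat N0 Nk)/= -[RHS]addr0; congr (_ + _).
rewrite big_nat_cond big1// => j /andP[/andP[Nj _] _].
exact: fN.
Qed.

Definition supp_ind (x : nat -> R) (j : nat) : R := (0 < `|x j|)%R%:R.

(** The tails of a convergent series with terms 0 and 1 are eventually below 1,
hence 0. *)
Lemma nsupp_lty_finite (x : nat -> R) : (nsupp x < +oo)%E ->
  exists N, forall j, (N <= j)%N -> x j = 0.
Proof.
move=> xoo.
have e0 j : (0 <= (supp_ind x j)%:E)%E by rewrite lee_fin.
have foo : (\sum_(0 <= j <oo) (supp_ind x j)%:E < +oo)%E.
  rewrite (@nneseries_split _ _ _ 1)//= add0n big_nat1 lte_add_pinfty//.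
  by rewrite ltry.
have := nneseries_tail_cvg foo (fun k _ => e0 k).
move=> /fine_cvgP[[M _ fin] /cvgrPdist_lt /(_ _ ltr01)[N _ H]].
exists (maxn M N) => j; rewrite geq_max => /andP[Mj Nj].
have := H _ Nj; have := fin _ Mj; rewrite /= sub0r normrN => finj.
have : ((supp_ind x j)%:E <= \sum_(j <= k <oo) (supp_ind x k)%:E)%E.
  apply: le_trans (@nneseries_lim_ge _ _ xpredT _ j.+1 _) => [|k _ _ //].
  by rewrite big_nat1.
rewrite -{1}(fineK finj) lee_fin => le1 /(le_lt_trans (ler_norm _)) /(le_lt_trans le1).
by rewrite /supp_ind normr_gt0; case: eqVneq => //= _; rewrite ltxx.
Qed.

Lemma nsupp_finite_support (x : nat -> R) (N : nat) : (0 < N)%N ->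
  (forall j, (N <= j)%N -> x j = 0) ->
  nsupp x = (\sum_(1 <= j < N) supp_ind x j)%:E.
Proof.
move=> N0 xN; rewrite -sumEFin.
apply: lim_near_cst => //; exists N => // k /= Nk.
rewrite (big_cat_nat N0 Nk)/= -[RHS]adde0; congr (_ + _)%E.
rewrite big_nat_cond big1// => j /andP[/andP[Nj _] _].
by rewrite xN// normr0 ltxx.
Qed.

Lemma common_support (G : seq (nat -> R)) :
  (forall g, g \in G -> (nsupp g < +oo)%E) ->
  exists2 N, (0 < N)%N & forall g, g \in G -> forall j, (N <= j)%N -> g j = 0.
Proof.
elim: G => [_|g G IH H]; first by exists 1%N.
have [|N N0 HN] := IH; first by move=> f fG; apply: H; rewrite in_cons fG orbT.
have [M HM] := nsupp_lty_finite (H g (mem_head _ _)).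
exists (maxn N M); first by rewrite leq_max N0.
move=> f; rewrite in_cons => /predU1P[->|fG] j; rewrite geq_max => /andP[Nj Mj].
  exact: HM.
exact: HN.
Qed.

End finite_support.

(** * Moments of the observed Fourier coefficients *)

Section observed_noise.
Context {R : realType}.
Notation mu := (@lebesgue_measure R).
Variables (n : nat) (n_gt0 : (0 < n)%N) (S : signal R).
Variables (Q : probability (skorokhod R n) R) (sigma : R).
Hypothesis noise : noise_condition Q sigma.
Variable theta : nat -> skorokhod R n -> R.
Hypothesis thetaP : forall j, (1 <= j)%N ->
  is_integral (obs_law Q S) (coord_process n) n%:R (phi j)
    (fun y => n%:R * theta j y).

Local Notation P := (obs_law Q S).
Local Notation t := (fourier_coef S).
Local Notation N0 := (n%:R : R).

Let n0 : N0 != 0. Proof. by rewrite pnatr_eq0 -lt0n. Qed.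
Let np : 0 < N0. Proof. by rewrite ltr0n. Qed.

Lemma integral_obs_law (f : skorokhod R n -> R) : measurable_fun setT f ->
  (forall y, 0 <= f y) ->
  (\int[P]_y (f y)%:E = \int[Q]_w (f (obs S w))%:E)%E.
Proof.
move=> mf f0; rewrite ge0_integral_distribution//.
exact/measurable_EFinP.
Qed.

Lemma measurable_theta (j : nat) : (1 <= j)%N -> measurable_fun setT (theta j).
Proof.
move=> j1; have [mt _] := thetaP j1.
rewrite (_ : theta j = (fun y => N0^-1 * (N0 * theta j y))); first exact: measurable_funM.
by apply/funext => y; rewrite mulKf.
Qed.

Lemma measurable_obs_comp (f : skorokhod R n -> R) :
  measurable_fun setT f -> measurable_fun setT (fun w => f (obs S w)).
Proof. by move=> mf; apply: measurableT_comp mf _; exact: measurable_obs. Qed.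

Lemma sq_integrable_phi j : sq_integrable N0 (phi j).
Proof. exact: (sqint_phi N0 j). Qed.

Lemma sq_integrable_trig_sum r c : sq_integrable N0 (trig_sum r c).
Proof. exact: (sqint_trig_sum N0 r c). Qed.

Lemma measurable_noise_int f : sq_integrable N0 f ->
  measurable_fun setT (noise_int Q f).
Proof. by move=> sf; have [[mZ _] _ _ _] := noise sf. Qed.

Lemma obs_noise_is_integral (j : nat) : (1 <= j)%N ->
  is_integral Q (coord_process n) N0 (phi j)
    (fun w => N0 * (theta j (obs S w) - t j)).
Proof.
move=> j1; have := is_integral_obs (sqint_phi N0 j) (thetaP j1).
rewrite integral_phi_signal; congr is_integral.
by apply/funext => w; rewrite mulrBr.
Qed.

(** A stochastic integral is determined almost surely by its integrand. *)
Lemma noise_int_phi :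
  {ae Q, forall w, forall j, (1 <= j)%N ->
    noise_int Q (phi j) w = N0 * (theta j (obs S w) - t j)}.
Proof.
apply/ae_foralln => j; have [->|j1] := posnP j; first exact: aeW.
have [_ + _ _] := noise (sq_integrable_phi j).
move=> /(_ _ (obs_noise_is_integral j1)); apply: filterS => w -> //.
Qed.

Lemma noise_int_trig_sum (r : seq nat) (c : nat -> R) : all (leq 1) r ->
  {ae Q, forall w, noise_int Q (trig_sum r c) w =
    N0 * lin_fluct r t (theta ^~ (obs S w)) c}.
Proof.
move=> r1; have [_ + _ _] := noise (sq_integrable_trig_sum r c).
have := @is_integral_trig_sum R _ _ Q (coord_process n) N0 (@measurable_coord R n) r c
  _ (fun j jr => obs_noise_is_integral (allP r1 _ jr)).
move=> H /(_ _ H); apply: filterS => w <-.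
by rewrite /lin_fluct mulr_sumr; apply: eq_bigr => j _; rewrite mulrCA.
Qed.

(** A linear combination of coefficients is the integral of one trigonometric
sum, so the variance bound for integrals applies to it as a whole; the
squared norm of the sum over [[0, n]] is [n] times that over one period. *)
Lemma lin_fluct_mean (r : seq nat) (c : nat -> R) : uniq r -> all (leq 1) r ->
  (\int[P]_y ((lin_fluct r t (theta ^~ y) c) ^+ 2)%:E <=
     (sigma / N0 * \sum_(j <- r) (c j) ^+ 2)%:E)%E.
Proof.
move=> ur r1.
have mlin : measurable_fun setT (fun y => lin_fluct r t (theta ^~ y) c).
  apply: measurable_lin_fluct => j jr; apply: measurable_theta; exact: (allP r1).
have [_ _ _] := noise (sq_integrable_trig_sum r c).
rewrite integral_trig_sum_sqr// unlock.
rewrite integral_obs_law; [|exact: measurable_funX|by move=> y; exact: sqr_ge0].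
have -> : (\int[Q]_w (noise_int Q (trig_sum r c) w ^+ 2)%:E =
    (N0 ^+ 2)%:E * \int[Q]_w ((lin_fluct r t (theta ^~ (obs S w)) c) ^+ 2)%:E)%E.
  rewrite -ge0_integralZl_EFin ?sqr_ge0//; last 2 first.
  - by move=> w _; rewrite lee_fin sqr_ge0.
  - apply/measurable_EFinP; apply: measurable_funX.
    exact: (measurable_obs_comp mlin).
  apply: ge0_ae_eq_integral => //.
  - by apply/measurable_EFinP; apply: measurable_funX; exact: measurable_noise_int (sq_integrable_trig_sum r c).
  - apply/measurable_EFinP; apply: measurable_funM => //; apply: measurable_funX.
    exact: (measurable_obs_comp mlin).
  - by move=> w _; rewrite lee_fin sqr_ge0.
  - by move=> w _; rewrite -EFinM lee_fin mulr_ge0// sqr_ge0.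
  - apply: filterS (noise_int_trig_sum c r1) => w /= -> _.
    by rewrite -EFinM exprMn.
rewrite -EFinM -lee_pdivlMl ?exprn_gt0// -EFinM => /le_trans; apply.
rewrite lee_fin le_eqVlt; apply/orP; left; apply/eqP; field.
exact: n0.
Qed.

Definition scaled_var (j : nat) : R := noise_var Q j / N0.

Lemma var_fin (j : nat) : (1 <= j)%N ->
  (\int[P]_y ((theta j y - t j) ^+ 2)%:E < +oo)%E.
Proof.
move=> j1.
have := @lin_fluct_mean [:: j] (fun=> 1) isT.
rewrite /= j1 => /(_ isT).
under eq_integral do rewrite /lin_fluct big_seq1 mul1r.
by move=> /le_lt_trans; apply; rewrite ltry.
Qed.

Let mdev (j : nat) : (1 <= j)%N -> measurable_fun setT (fun y => theta j y - t j).
Proof. by move=> j1; apply: measurable_funB => //; exact: measurable_theta. Qed.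

Lemma sqint_dev (j : nat) : (1 <= j)%N -> sqint P setT (fun y => theta j y - t j).
Proof. by move=> j1; split; [exact: mdev|exact: var_fin]. Qed.

Lemma dev_mean0 (j : nat) : (1 <= j)%N ->
  P.-integrable setT (fun y => (theta j y - t j)%:E) /\
  (\int[P]_y (theta j y - t j)%:E = 0)%E.
Proof.
move=> j1.
have sint (P' : probability (skorokhod R n) R) (f : skorokhod R n -> R) :
    sqint P' setT f -> P'.-integrable setT (EFin \o f).
  move=> sf; have s1 : sqint P' setT (fun=> 1).
    split; first exact: measurable_cst.
    under eq_integral do rewrite expr1n.
    by rewrite integral_cst//= probability_setT mule1 ltry.
  have := sqint_integrableM measurableT sf s1.
  by apply: eq_integrable => // w _ /=; rewrite mulr1.
split; first exact: sint (sqint_dev j1).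
have sQ : sqint Q setT (fun w => theta j (obs S w) - t j).
  split; first exact: (measurable_obs_comp (mdev j1)).
  rewrite -(@integral_obs_law (fun y => (theta j y - t j) ^+ 2)); first exact: var_fin.
    by apply: measurable_funX; exact: mdev.
  by move=> y; exact: sqr_ge0.
have iQ := sint _ _ sQ.
rewrite (@integral_distribution _ _ _ _ _ _ (@obs R n S) (fun y => (theta j y - t j)%:E))//; last first.
  by apply/measurable_EFinP; exact: mdev.
have [_ _ + _] := noise (sq_integrable_phi j); rewrite unlock => mean.
have : (N0%:E * \int[Q]_w (theta j (obs S w) - t j)%:E = 0)%E.
  rewrite -integralZl// -mean; apply: ae_eq_integral => //.
  - by apply/measurable_EFinP; apply: measurable_funM => //; exact: (measurable_obs_comp (mdev j1)).
  - by apply/measurable_EFinP; exact: measurable_noise_int (sq_integrable_phi j).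
  - by apply: filterS noise_int_phi => w H _ /=; rewrite H.
by move=> /eqP; rewrite mule_eq0 eqe (negbTE n0)/= => /eqP.
Qed.

Lemma noise_coefE :
  {ae Q, forall w, forall j, (1 <= j)%N ->
    noise_coef Q j w ^+ 2 = N0 * (theta j (obs S w) - t j) ^+ 2}.
Proof.
apply: filterS noise_int_phi => w H j j1.
rewrite /noise_coef H// !exprMn exprVn sqr_sqrtr ?ler0n// expr2; field.
exact: n0.
Qed.

Lemma dev_var (j : nat) : (1 <= j)%N ->
  (\int[P]_y ((theta j y - t j) ^+ 2)%:E = (scaled_var j)%:E)%E.
Proof.
move=> j1.
have fin : (\int[P]_y ((theta j y - t j) ^+ 2)%:E)%E \is a fin_num.
  by rewrite ge0_fin_numE ?var_fin//; apply: integral_ge0 => y _; rewrite lee_fin sqr_ge0.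
rewrite /scaled_var /noise_var unlock.
have -> : (\int[Q]_w (noise_coef Q j w ^+ 2)%:E =
    N0%:E * \int[P]_y ((theta j y - t j) ^+ 2)%:E)%E.
  rewrite integral_obs_law; [|by apply: measurable_funX; exact: mdev|by move=> y; exact: sqr_ge0].
  have mw : measurable_fun setT (fun w => ((theta j (obs S w) - t j) ^+ 2)).
    by apply: measurable_funX; exact: (measurable_obs_comp (mdev j1)).
  rewrite -ge0_integralZl_EFin//; last 2 first.
  - by move=> w _; rewrite lee_fin sqr_ge0.
  - exact/measurable_EFinP.
  apply: ge0_ae_eq_integral => //.
  - apply/measurable_EFinP; apply: measurable_funX; apply: measurable_funM => //.
    exact: measurable_noise_int (sq_integrable_phi j).
  - by apply/measurable_EFinP; exact: measurable_funM.
  - by move=> w _; rewrite lee_fin sqr_ge0.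
  - by move=> w _; rewrite -EFinM lee_fin mulr_ge0// sqr_ge0.
  - by apply: filterS noise_coefE => w H _; rewrite H.
by rewrite fineM//= mulrAC divff// mul1r fineK.
Qed.

Variables (l vs : R).
Hypothesis L12 : (L1 vs Q + L2 Q <= l%:E)%E.

Let zero_adm : [set x : nat -> R | (forall j, -1 <= x j <= 1) /\ (nsupp x <= N0%:E)%E] (fun=> 0).
Proof.
split; first by move=> j; lra.
by rewrite (@nsupp_finite_support _ _ 1)// big_geq// lee_fin.
Qed.

Lemma L1_ge0 : (0 <= L1 vs Q)%E.
Proof.
apply: le_trans (ereal_sup_ubound _); last by exists (fun=> 0); [exact: zero_adm|reflexivity].
by rewrite lee_fin.
Qed.

Lemma L2_ge0 : (0 <= L2 Q)%E.
Proof.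
apply: le_trans (ereal_sup_ubound _); last first.
  exists (fun=> 0) => //; split; last by case: zero_adm.
  rewrite /sqnorm (@series_finite_support _ _ 1)// ?big_geq//.
  by move=> j _; rewrite expr0n.
by rewrite unlock; apply: integral_ge0 => w _; rewrite lee_fin sqr_ge0.
Qed.

Lemma L1_le : (L1 vs Q <= l%:E)%E.
Proof. by apply: le_trans L12; rewrite leeDl// L2_ge0. Qed.

Lemma L2_le : (L2 Q <= l%:E)%E.
Proof. by apply: le_trans L12; rewrite leeDr// L1_ge0. Qed.

Variable N : nat.
Hypothesis N_gt0 : (0 < N)%N.
Local Notation r := (index_iota 1 N).

Lemma bias_le (x : nat -> R) :
  (forall j, (1 <= j)%N -> -1 <= x j <= 1) -> (forall j, (N <= j)%N -> x j = 0) ->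
  (nsupp x <= N0%:E)%E ->
  `|\sum_(j <- r) x j * (scaled_var j - vs / N0)| <= l / N0.
Proof.
move=> x1 xN xn.
(* Index 0 lies outside the series, but the constraint in L1 ranges over it. *)
pose x' j := if (0 < j)%N then x j else 0.
have x'N j : (N <= j)%N -> x' j = 0.
  by rewrite /x' => Nj; rewrite xN//; case: ifP.
have H : (`|\sum_(1 <= j <oo) x' j * (noise_var Q j - vs)|%:E <= l%:E)%E.
  apply: le_trans L1_le; apply: ereal_sup_ubound; exists x' => //; split.
    by move=> j; rewrite /x'; case: ifP => [j0|_]; [exact: x1|lra].
  rewrite (nsupp_finite_support N_gt0 x'N).
  move: xn; rewrite (nsupp_finite_support N_gt0 xN); congr (_%:E <= _)%E.
  by apply: eq_big_nat => j /andP[j1 _]; rewrite /supp_ind /x' j1.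
move: H; rewrite lee_fin (series_finite_support N_gt0); last first.
  by move=> j Nj; rewrite x'N// mul0r.
rewrite ler_pdivlMr// -[X in `|_| * X <= _](gtr0_norm np) -normrM mulr_suml.
congr (`|_| <= _); apply: eq_big_nat => j /andP[j1 _].
rewrite /x' j1 /scaled_var; field; exact: n0.
Qed.

(** [L2] applies to [g / |g|], which has the same support as [g]. *)
Lemma quad_fluct_mean (g : nat -> R) :
  (forall j, (N <= j)%N -> g j = 0) -> (nsupp g <= N0%:E)%E ->
  0 < \sum_(j <- r) (g j) ^+ 2 ->
  (\int[P]_y ((quad_fluct r t (theta ^~ y) scaled_var g) ^+ 2)%:E <=
     (l / N0 ^+ 2 * \sum_(j <- r) (g j) ^+ 2)%:E)%E.
Proof.
move=> gN gn; set q := \sum_(j <- r) _ => q0.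
have r1 j : j \in r -> (1 <= j)%N by rewrite mem_index_iota => /andP[].
have sq0 : 0 < Num.sqrt q by rewrite sqrtr_gt0.
pose x j := g j / Num.sqrt q.
have xN j : (N <= j)%N -> x j = 0 by move=> Nj; rewrite /x gN// mul0r.
have H : (\int[Q]_w ((\sum_(j <- r) x j * (noise_coef Q j w ^+ 2 - noise_var Q j)) ^+ 2)%:E
    <= l%:E)%E.
  apply: le_trans L2_le; apply: ereal_sup_ubound; exists x.
    split.
      rewrite /sqnorm (series_finite_support N_gt0); last by move=> j /xN ->; rewrite expr0n.
      rewrite (@eq_bigr _ _ _ _ _ _ _ (fun j => q^-1 * (g j) ^+ 2)); last first.
        by move=> j _; rewrite /x expr_div_n sqr_sqrtr ?(ltW q0)// mulrC.
      by rewrite -mulr_sumr mulVf// gt_eqF.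
    rewrite (nsupp_finite_support N_gt0 xN).
    move: gn; rewrite (nsupp_finite_support N_gt0 gN); congr (_%:E <= _)%E.
    apply: eq_bigr => j _; rewrite /supp_ind /x !normr_gt0 mulf_eq0 invr_eq0.
    by rewrite (gt_eqF sq0) orbF.
  rewrite unlock; apply: eq_integral => w _; rewrite (series_finite_support N_gt0)//.
  by move=> j /xN ->; rewrite mul0r.
have mq : measurable_fun setT (fun y => quad_fluct r t (theta ^~ y) scaled_var g).
  by apply: measurable_quad_fluct => j jr; apply: measurable_theta; exact: r1.
rewrite integral_obs_law; [|exact: measurable_funX|by move=> y; exact: sqr_ge0].
move: H.
have -> : (\int[Q]_w ((\sum_(j <- r) x j * (noise_coef Q j w ^+ 2 - noise_var Q j)) ^+ 2)%:E =
   (N0 ^+ 2 / q)%:E * \int[Q]_w ((quad_fluct r t (theta ^~ (obs S w)) scaled_var g) ^+ 2)%:E)%E.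
  rewrite -ge0_integralZl_EFin//; last 3 first.
  - by move=> w _; rewrite lee_fin sqr_ge0.
  - by apply/measurable_EFinP; apply: measurable_funX; exact: (measurable_obs_comp mq).
  - by rewrite divr_ge0 ?sqr_ge0// ltW.
  apply: ge0_ae_eq_integral => //.
  - apply/measurable_EFinP; apply: measurable_funX; apply: measurable_sum => j.
    apply: measurable_funM => //; apply: measurable_funB => //; apply: measurable_funX.
    by apply: measurable_funM => //; exact: measurable_noise_int (sq_integrable_phi j).
  - apply/measurable_EFinP; apply: measurable_funM => //; apply: measurable_funX.
    exact: (measurable_obs_comp mq).
  - by move=> w _; rewrite lee_fin sqr_ge0.
  - by move=> w _; rewrite -EFinM lee_fin mulr_ge0 ?sqr_ge0// divr_ge0 ?sqr_ge0// ltW.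
  - apply: filterS noise_coefE => w Hw _.
    rewrite -EFinM; congr _%:E.
    have -> : \sum_(j <- r) x j * (noise_coef Q j w ^+ 2 - noise_var Q j) =
       N0 / Num.sqrt q * quad_fluct r t (theta ^~ (obs S w)) scaled_var g.
      rewrite /quad_fluct mulr_sumr; apply: eq_big_seq => j jr.
      rewrite Hw ?r1// /x /scaled_var; field.
      by rewrite n0 gt_eqF.
    by rewrite exprMn expr_div_n sqr_sqrtr// ltW.
rewrite -lee_pdivlMl ?divr_gt0 ?exprn_gt0// -EFinM => /le_trans; apply.
rewrite lee_fin le_eqVlt; apply/orP; left; apply/eqP; field.
by rewrite n0 gt_eqF.
Qed.

End observed_noise.

(** * The robust oracle inequality *)

Section extrema.
Context {R : realType} {T : eqType}.
Local Open Scope ereal_scope.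

Lemma le_bigmaxe (G : seq T) (f : T -> \bar R) g : g \in G ->
  f g <= \big[maxe/0]_(i <- G) f i.
Proof.
elim: G => // h G IH; rewrite in_cons big_cons le_max => /predU1P[->|/IH ->].
  by rewrite lexx.
by rewrite orbT.
Qed.

Lemma bigmaxe_le (G : seq T) (f : T -> \bar R) u : 0 <= u ->
  (forall g, g \in G -> f g <= u) -> \big[maxe/0]_(i <- G) f i <= u.
Proof.
move=> u0; elim: G => [|h G IH] H; first by rewrite big_nil.
rewrite big_cons ge_max H ?mem_head//= IH// => g gG.
by apply: H; rewrite in_cons gG orbT.
Qed.

Lemma bigmine_attained (G : seq T) (f : T -> \bar R) : G != [::] ->
  exists2 g, g \in G & \big[mine/+oo]_(i <- G) f i = f g.
Proof.
elim: G => // h G IH _; rewrite big_cons.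
have [->|/IH[g gG ->]] := eqVneq G [::].
  by exists h; rewrite ?mem_head// big_nil /mine ltey; case: eqP => //= ->.
have [hg|gh] := leP (f h) (f g).
  by exists h; rewrite ?mem_head.
by exists g; rewrite ?in_cons ?gG ?orbT.
Qed.

End extrema.

Section estimators_as_sums.
Context {R : realType} (n : nat) (N : nat) (N_gt0 : (0 < N)%N).
Notation mu := (@lebesgue_measure R).
Variables (theta : nat -> skorokhod R n -> R) (S : signal R).
Local Notation r := (index_iota 1 N).

Lemma wls_lossE (g : nat -> R) (y : skorokhod R n) :
  (forall j, (N <= j)%N -> g j = 0) ->
  (\int[mu]_(x in `[0%R, 1%R]) ((wls_estimator theta g y x - S x) ^+ 2)%:E =
   (seq_loss r (sqr_norm S) (fourier_coef S) (theta ^~ y) g)%:E)%E.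
Proof.
move=> gN.
have r1 : all (leq 1) r by apply/allP => j; rewrite mem_index_iota => /andP[].
transitivity (\int[mu]_(x in `[0%R, 1%R])
    ((trig_sum r (fun j => g j * theta j y) x - S x) ^+ 2)%:E)%E.
  apply: eq_integral => x _; congr ((_ - _) ^+ 2)%:E.
  rewrite /wls_estimator (series_finite_support N_gt0)// => j Nj.
  by rewrite gN// !mul0r.
rewrite integral_loss ?iota_uniq// /seq_loss.
by congr (_ - _ + _)%:E; apply: eq_bigr => j _; rewrite exprMn.
Qed.

Lemma costE (sighat : skorokhod R n -> R) (rho : R) (g : nat -> R) (y : skorokhod R n) :
  (forall j, (N <= j)%N -> g j = 0) ->
  cost theta sighat rho g y = seq_cost r (sighat y / n%:R) rho (theta ^~ y) g.
Proof.
move=> gN; rewrite /cost /seq_cost /penalty /sqnorm.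
rewrite !(series_finite_support N_gt0); [|by move=> j Nj; rewrite gN// ?expr0n/= ?mul0r..].
by rewrite [sighat y * _ / _]mulrAC.
Qed.

End estimators_as_sums.

(** After clearing [rho (1 - 3 rho)], the coefficient of [l] that comes from the
bias is [rho (1 - rho) (4 + 2 rho)], at most 4; the ratio [vhi / vlo] of the
target is at least 1. *)
Lemma remainder_le (R : realFieldType) (n nu vs vlo vhi sg shi l rho : R) :
  0 < n -> 0 <= nu -> 0 < rho < 1 / 3 -> 0 < vlo -> vlo <= vs -> vs <= vhi ->
  0 < sg -> sg <= shi -> 0 < l ->
  ((1 - rho) * (4 + 2 * rho) * (l / n)
     + nu * (2 * (l / n ^+ 2) / (rho * (vs / n)) + sg / n / rho)) / (1 - 3 * rho)
  <= n^-1 * ((2 * vhi * shi * nu + 4 * vhi * l + 2 * nu * l) /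
  (vlo * rho * (1 - 3 * rho))).
Proof.
move=> n0 nu0 /andP[rho0 rho3] vlo0 vlos vshi sg0 sgshi l0.
have q0 : 0 < 1 - 3 * rho by lra.
have vs0 : 0 < vs by lra.
have -> : ((1 - rho) * (4 + 2 * rho) * (l / n)
     + nu * (2 * (l / n ^+ 2) / (rho * (vs / n)) + sg / n / rho)) / (1 - 3 * rho)
  = n^-1 * (((rho * (1 - rho) * (4 + 2 * rho)) * l + nu * (2 * l / vs + sg)) / (rho * (1 - 3 * rho))).
  by field; rewrite !gt_eqF.
have -> : n^-1 * ((2 * vhi * shi * nu + 4 * vhi * l + 2 * nu * l) /
  (vlo * rho * (1 - 3 * rho))) =
  n^-1 * (((2 * vhi * shi * nu + 4 * vhi * l + 2 * nu * l) / vlo) / (rho * (1 - 3 * rho))).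
  by field; rewrite !gt_eqF.
rewrite ler_wpM2l ?invr_ge0 ?(ltW n0)// ler_wpM2r//.
  by rewrite invr_ge0 mulr_ge0 ?ltW.
have -> : (2 * vhi * shi * nu + 4 * vhi * l + 2 * nu * l) / vlo =
    (vhi / vlo) * (2 * (shi * nu) + 4 * l) + nu * (2 * l / vlo).
  by field; rewrite gt_eqF.
have v1 : 1 <= vhi / vlo by rewrite ler_pdivlMr// mul1r; lra.
have H1 : nu * (2 * l / vs) <= nu * (2 * l / vlo).
  by rewrite ler_wpM2l// ler_wpM2l ?lef_pV2 ?posrE//; lra.
have H2 : nu * sg <= shi * nu by rewrite mulrC ler_wpM2r.
have H3 : rho * (1 - rho) * (4 + 2 * rho) * l <= 4 * l.
  by rewrite ler_wpM2r ?(ltW l0)//; nra.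
have p : 0 <= 2 * (shi * nu) + 4 * l by rewrite addr_ge0// !mulr_ge0// ltW//; lra.
have := ler_wpM2r p v1.
have : 0 <= shi * nu by rewrite mulr_ge0//; lra.
move: H1 H2 H3; rewrite mul1r mulrDr; lra.
Qed.

Theorem theorem3p3 (R : realType) (n : nat) (n_gt0 : (0 < n)%N)
  (S : signal R)
  (QQ : set (probability (skorokhod R n) R))
  (sigma varsigma : probability (skorokhod R n) R -> R)
  (semimart : forall Q, QQ Q -> semimartingale_law Q)
  (sigma_gt0 : forall Q, QQ Q -> 0 < sigma Q)
  (varsigma_gt0 : forall Q, QQ Q -> 0 < varsigma Q)
  (noiseP : forall Q, QQ Q -> noise_condition Q (sigma Q))
  (l : nat -> R)
  (l_gt0 : forall m, (0 < m)%N -> 0 < l m)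
  (l_incr : forall m k, (0 < m)%N -> (m <= k)%N -> l m <= l k)
  (l_cvg : l m @[m --> \oo] --> +oo)
  (l_slow : forall delta : R, 0 < delta ->
    l m / (m%:R `^ delta) @[m --> \oo] --> (0 : R))
  (L12_le : forall Q, QQ Q -> (L1 (varsigma Q) Q + L2 Q <= (l n)%:E)%E)
  (varsigma_lo : 0 < inf (varsigma @` QQ))
  (varsigma_hi : has_ubound (varsigma @` QQ))
  (sigma_hi : has_ubound (sigma @` QQ))
  (theta : nat -> skorokhod R n -> R)
  (thetaP : forall Q, QQ Q -> forall j, (1 <= j)%N ->
    is_integral (obs_law Q S) (coord_process n) n%:R (phi j)
      (fun y => n%:R * theta j y))
  (Gamma : {fset nat -> R})
  (Gamma_neq0 : Gamma != fset0)
  (Gamma_weight : forall g, g \in Gamma ->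
    (forall j, (1 <= j)%N -> 0 <= g j <= 1) /\
    (0 < nsupp g <= n%:R%:E)%E)
  (sighat : skorokhod R n -> R)
  (sighat_meas : measurable_fun setT sighat)
  (rho : R) (rho_bd : 0 < rho < 1 / 3)
  (ghat : skorokhod R n -> nat -> R)
  (ghatP : cost_minimizer theta sighat rho Gamma ghat) :
  (robust_risk QQ S (selected_estimator theta ghat) <=
   ((1 + 3 * rho - 2 * rho ^+ 2) / (1 - 3 * rho))%:E *
     \big[mine/+oo%E]_(g <- Gamma) robust_risk QQ S (wls_estimator theta g) +
   (n%:R^-1)%:E * B_star QQ sigma varsigma (l n) Gamma S sighat rho)%E.
Proof.
have Gamma_lty g : g \in Gamma -> (nsupp g < +oo)%E.
  by move=> /Gamma_weight[_ /andP[_ /le_lt_trans]]; apply; exact: ltry.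
have [N N0 suppN] := @common_support R Gamma Gamma_lty.
pose r := index_iota 1 N.
have r_uniq : uniq r by exact: iota_uniq.
have r1 j : j \in r -> (1 <= j)%N by rewrite mem_index_iota => /andP[].
have r1' : all (leq 1) r by apply/allP.
have np : 0 < n%:R :> R by rewrite ltr0n.
have Gamma01 g j : g \in Gamma -> (1 <= j)%N -> 0 <= g j <= 1.
  by move=> /Gamma_weight[+ _]; apply.
have [g0 g0G min0] := bigmine_attained (fun g => robust_risk QQ S (wls_estimator theta g))
  (Gamma_neq0 : (Gamma : seq _) != [::]).
pose m := fine (max_supp Gamma).
have mE : max_supp Gamma = m%:E.
  rewrite /m fineK// ge0_fin_numE; last first.
    apply: le_trans (le_bigmaxe nsupp g0G).
    by have [_ /andP[/ltW]] := Gamma_weight g0 g0G.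
  apply: (@le_lt_trans _ _ (n%:R%:E)); last exact: ltry.
  apply: bigmaxe_le => [|g gG]; first by rewrite lee_fin ler0n.
  by have [_ /andP[]] := Gamma_weight g gG.
have [ghat_in ghat_min mghat] := ghatP.
rewrite min0 /B_star mE.
apply: ge_ereal_sup => _ [Q QQQ <-].
have [noiseQ thetaQ] := (noiseP Q QQQ, thetaP Q QQQ).
pose s := varsigma Q / n%:R.
have s0 : 0 < s by rewrite divr_gt0// varsigma_gt0.
have supp_gt0 g : g \in Gamma -> 0 < \sum_(j <- r) supp_ind g j.
  move=> gG; have [_ /andP[+ _]] := Gamma_weight g gG.
  by rewrite (nsupp_finite_support N0 (suppN g gG)).
have sum_le_m g : g \in Gamma -> \sum_(j <- r) g j <= m.
  move=> gG; rewrite -lee_fin -mE; apply: le_trans (le_bigmaxe nsupp gG).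
  rewrite (nsupp_finite_support N0 (suppN g gG)) lee_fin.
  rewrite big_seq [leRHS]big_seq; apply: ler_sum => j /r1 j1.
  have /andP[gj0 gj1] := Gamma01 g j gG j1.
  have [e|gn] := eqVneq (g j) 0; first by rewrite /supp_ind e normr0 ltxx.
  by rewrite /supp_ind normr_gt0 gn.
have sq_gt0 g : g \in Gamma -> 0 < \sum_(j <- r) g j ^+ 2.
  move=> gG; rewrite lt_neqAle eq_sym sumr_ge0 ?andbT; last by move=> j _; exact: sqr_ge0.
  apply: contraTneq (supp_gt0 g gG) => /eqP; rewrite psumr_eq0 => [/allP H|j _]; last exact: sqr_ge0.
  rewrite big_seq big1 ?ltxx// => j /H; rewrite sqrf_eq0 => /eqP gj.
  by rewrite /supp_ind gj normr0 ltxx.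
have bias g : g \in Gamma ->
    `|\sum_(j <- r) g j * (scaled_var Q j - s)| <= l n / n%:R.
  move=> gG; apply: (bias_le n_gt0 (L12_le Q QQQ)) => //.
  - by move=> j /(Gamma01 g j gG); lra.
  - exact: suppN.
  - by have [_ /andP[]] := Gamma_weight g gG.
have bias_sqr g : g \in Gamma ->
    `|\sum_(j <- r) g j ^+ 2 * (scaled_var Q j - s)| <= l n / n%:R.
  move=> gG; apply: (bias_le n_gt0 (L12_le Q QQQ) N0 (x := fun j => g j ^+ 2)) => //.
  - by move=> j /(Gamma01 g j gG) /andP[? ?]; nra.
  - by move=> j /(suppN g gG) ->; rewrite expr0n.
  - have [_ /andP[_]] := Gamma_weight g gG; congr (_ <= _)%E.
    rewrite (nsupp_finite_support N0 (suppN g gG)) (@nsupp_finite_support _ _ N)//.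
      by congr _%:E; apply: eq_bigr => j _; rewrite /supp_ind !normr_gt0 sqrf_eq0.
    by move=> j /(suppN g gG) ->; rewrite expr0n.
have min_seq y g : g \in Gamma ->
    seq_cost r (sighat y / n%:R) rho (theta^~ y) (ghat y) <=
    seq_cost r (sighat y / n%:R) rho (theta^~ y) g.
  move=> gG; rewrite -!(costE N0)//; [exact: ghat_min|exact: suppN|].
  exact: suppN (ghat_in y).
have oracle := @mean_oracle _ _ R (obs_law Q S) r (fourier_coef S) (scaled_var Q) theta
  (sqr_norm S) (bessel S r_uniq r1') (fun j jr => measurable_theta n_gt0 thetaQ (r1 j jr))
  (fun j jr => dev_mean0 n_gt0 noiseQ thetaQ (r1 j jr))
  (fun j jr => dev_var n_gt0 noiseQ thetaQ (r1 j jr))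
  Gamma s rho m (l n / n%:R) (l n / n%:R ^+ 2) (sigma Q / n%:R)
  (fun y => sighat y / n%:R) ghat rho_bd s0.
have /(_ _ g0G) {}oracle := oracle
  (divr_ge0 (ltW (sigma_gt0 Q QQQ)) (ler0n _ n))
  (fun g gG j jr => Gamma01 g j gG (r1 j jr)) sum_le_m sq_gt0 bias bias_sqr
  (fun c => lin_fluct_mean n_gt0 noiseQ thetaQ c r_uniq r1')
  (fun g gG => quad_fluct_mean n_gt0 noiseQ thetaQ (L12_le Q QQQ) N0 (suppN g gG)
     (proj2 (andP (Gamma_weight g gG).2)) (sq_gt0 g gG))
  (measurable_funM sighat_meas (measurable_cst _)) ghat_in
  min_seq mghat.
have riskE g : g \in Gamma -> risk Q S (wls_estimator theta g) =
    (\int[obs_law Q S]_y (seq_loss r (sqr_norm S) (fourier_coef S) (theta^~ y) g)%:E)%E.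
  by move=> gG; apply: eq_integral => y _; rewrite (wls_lossE N0)//; exact: suppN.
have selE : risk Q S (selected_estimator theta ghat) =
    (\int[obs_law Q S]_y
       (seq_loss r (sqr_norm S) (fourier_coef S) (theta^~ y) (ghat y))%:E)%E.
  apply: eq_integral => y _; rewrite /selected_estimator (wls_lossE N0)//.
  exact: suppN (ghat_in y).
have /andP[rho0 rho3] := rho_bd.
have q0 : 0 < 1 - 3 * rho by lra.
have m0 : 0 <= m.
  apply: le_trans (sum_le_m g0 g0G); rewrite big_seq; apply: sumr_ge0 => j /r1 j1.
  by have /andP[] := Gamma01 g0 j g0G j1.
have errE : (\int[obs_law Q S]_y `|sighat y / n%:R - s|%:E =
    n%:R^-1%:E * 'E_(obs_law Q S)[fun y => `|sighat y - varsigma Q|%R])%E.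
  rewrite unlock -ge0_integralZl_EFin ?invr_ge0 ?ler0n//; last first.
    apply/measurable_EFinP; apply: measurableT_comp => //; exact: measurable_funB.
  apply: eq_integral => y _; rewrite -EFinM; congr _%:E.
  by rewrite -mulrBl normrM mulrC [X in X * _]ger0_norm// invr_ge0 ler0n.
have err0 : (0 <= 'E_(obs_law Q S)[fun y => `|sighat y - varsigma Q|%R])%E.
  by rewrite unlock; apply: integral_ge0 => y _; rewrite lee_fin.
rewrite selE (le_trans oracle)// errE -addeA leeD//.
  rewrite lee_pmul2l//; last by rewrite lte_fin divr_gt0//; nra.
  by rewrite -(riskE g0 g0G); apply: ereal_sup_ubound; exists Q.
rewrite muleDr//.
apply: leeD.
  rewrite -EFinM lee_fin; apply: remainder_le => //.
  - apply: ge_inf; last by exists Q.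
    by exists 0 => _ [Q' QQ' <-]; apply/ltW/varsigma_gt0.
  - by apply: ub_le_sup => //; exists Q.
  - exact: sigma_gt0.
  - by apply: ub_le_sup => //; exists Q.
  - exact: l_gt0.
rewrite EFinM muleA [leLHS]muleAC [leLHS]muleC.
rewrite lee_wpmul2l ?lee_fin ?invr_ge0 ?ler0n//.
rewrite lee_wpmul2l//.
  by rewrite -EFinM lee_fin mulr_ge0// divr_ge0// ltW.
by apply: ereal_sup_ubound; exists Q.
Qed.
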